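(* Let $r>0$, $\beta>0$, $\eta\in(0,1)$, and let $[a,b]\subset(0,\beta+\eta)\subset(0,1)$ with $b-a>r$. Let $\psi,g,F,A$ satisfy the standing assumptions listed in the context, let $\Phi$, $\gamma$, $k$ be the functions defined there, let $$c=\begin{cases}\min\Bigl\{\dfrac{a\beta}{\beta+\eta},\dfrac{\beta+\eta-b}{\beta+\eta}\Bigr\},&\beta+\eta\ge\frac12,\\[2mm]\min\Bigl\{\dfrac{a\beta}{1-(\beta+\eta)},\dfrac{\beta+\eta-b}{1-(\beta+\eta)}\Bigr\},&\beta+\eta<\frac12,\end{cases}$$ and suppose $\int_a^b\Phi(s)g(s)\,ds>0$. For $\rho>0$, say that $(\mathrm I^1_\rho)$ holds if $\rho>\|\psi\|_{[-r,0]}$ and $F^{(-\rho,\rho)}/m<1$, and that $(\mathrm I^0_\rho)$ holds if $F_{(\rho,\rho/c)}/M(a,b)>1$ (constants defined in the context). Then the functional boundary value problem $$-u''(t)=g(t)F(t,u_t),\ t\in[0,1];\qquad u(t)=\psi(t),\ t\in[-r,0];\qquad u(0)=0,\quad \beta u'(1)+u(\eta)=\alpha[u],$$ has at least one nontrivial solution, strictly positive on $[a,b]$, if either of the following holds: $(S_1)$ there exist $\rho_1,\rho_2\in(0,\infty)$ with $\|\psi\|_{[-r,0]}<\rho_2$ and $\rho_1/c<\rho_2$ such that $(\mathrm I^0_{\rho_1})$ and $(\mathrm I^1_{\rho_2})$ hold; $(S_2)$ there exist $\rho_1,\rho_2\in(0,\infty)$ with $\|\psi\|_{[-r,0]}<\rho_1<\rho_2$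 such that $(\mathrm I^1_{\rho_1})$ and $(\mathrm I^0_{\rho_2})$ hold.
   Context: For a compact interval $I$, $\|\cdot\|_I$ is the sup norm on $C(I,\mathbb R)$; $u_t(\theta)=u(t+\theta)$ for $\theta\in[-r,0]$; $\alpha[u]=\int_0^1u(s)\,dA(s)$ (Stieltjes integral). $H(\tau)=1$ for $\tau\ge0$ and $H(\tau)=0$ for $\tau<0$. For $t\in[-r,1]$, $s\in[0,1]$: $$\gamma(t)=\frac{t}{\beta+\eta}H(t),\qquad k(t,s)=\left[\frac{\beta t}{\beta+\eta}+\frac{t}{\beta+\eta}(\eta-s)H(\eta-s)-(t-s)H(t-s)\right]H(t),$$ $$\Phi(s)=\begin{cases}s,&\beta+\eta\ge\frac12,\\ \dfrac{1-(\beta+\eta)}{\beta+\eta}\,s,&\beta+\eta<\frac12.\end{cases}$$ By a solution of the boundary value problem is meant $u\in C([-r,1],\mathbb R)$ satisfying $$u(t)=\psi(t)+\int_0^1k(t,s)g(s)F(s,u_s)\,ds+\gamma(t)\alpha[u],\quad t\in[-r,1];$$ it is nontrivial if it does not coincide with $\psi$. Standing assumptions: - $\psi:[-r,1]\to\mathbb R$ is continuous with $\psi(t)=0$ for all $t\in[0,1]$. - $g:[0,1]\to\mathbb R$ is measurable, $g\ge0$ a.e., $g\Phi\in L^1[0,1]$. - $F:[0,1]\times C([-r,0],\mathbb R)\to[0,\infty)$; for each $\phi$, $t\mapsto F(t,\phi)$ is measurable; for a.e. $t$, $\phi\mapsto F(t,\phi)$ is continuous; for each $R>0$ there is $\varphi_R\in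 L^\infty[0,1]$ with $F(t,\phi)\le\varphi_R(t)$ for all $\phi$ with $\|\phi\|_{[-r,0]}\le R$ and a.e. $t\in[0,1]$. - $A$ is of bounded variation on $[0,1]$, $\mathcal K_A(s):=\int_0^1k(t,s)\,dA(t)\ge0$ for a.e. $s\in[0,1]$, and $0\le\alpha[\gamma]<1$. Constants: $$\frac1m=\sup_{t\in[0,1]}\left\{\int_0^1|k(t,s)|g(s)\,ds+\frac{|\gamma(t)|}{1-\alpha[\gamma]}\int_0^1\mathcal K_A(s)g(s)\,ds\right\},$$ $$\frac1{M(a,b)}=\inf_{t\in[a,b]}\left\{\int_{a+r}^bk(t,s)g(s)\,ds+\frac{\gamma(t)}{1-\alpha[\gamma]}\int_{a+r}^b\mathcal K_A(s)g(s)\,ds\right\},$$ $$F^{(-\rho,\rho)}=\sup\left\{\frac{F(t,\phi)}{\rho}:t\in[0,1],\ \phi\in C([-r,0],\mathbb R),\ \|\phi\|_{[-r,0]}\le\rho\right\},$$ $$F_{(\rho,\rho/c)}=\inf\left\{\frac{F(t,\phi)}{\rho}:t\in[a,b],\ \phi\in C([-r,0],\mathbb R),\ \phi(\theta)\in[\rho,\rho/c]\ \forall\theta\in[-r,0]\right\}.$$ Quotients by $m$ and $M(a,b)$ mean products with $\frac1m$ and $\frac1{M(a,b)}$. *)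

(* Defs.v *)
From mathcomp Require Import all_boot all_order all_algebra.
From mathcomp Require Import all_classical all_reals all_analysis.

Set Implicit Arguments.
Unset Strict Implicit.
Unset Printing Implicit Defensive.

Import Order.TTheory GRing.Theory Num.Theory.
Import numFieldNormedType.Exports.
Local Open Scope classical_set_scope.
Local Open Scope ring_scope.

Notation leb := completed_lebesgue_measure.

(* Measurability with respect to the Lebesgue (not Borel) sigma-algebra. *)
Definition lebesgue_measurable (R : realType) (D : set R) (f : R -> R) : Prop :=
  @measurable_fun _ _
    (caratheodory_type (mu_ext (wlength (idfun : R -> R)))) R D f.

(* Riemann-Stieltjes integral, as the limit over tagged partitions
   x_0 = p < x_1 < ... < x_n = q whose mesh tends to 0. *)
Definition is_RS_integral (R : realType) (p q : R) (A f : R -> R) (l : R) :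
    Prop :=
  forall eps : R, 0 < eps -> exists2 delta : R, 0 < delta &
    forall (s : seq R) (xi : nat -> R), itv_partition p q s ->
      let x := nth q (p :: s) in
      (forall i, (i < size s)%N ->
         x i.+1 - x i < delta /\ x i <= xi i <= x i.+1) ->
      `| \sum_(0 <= i < size s) f (xi i) * (A (x i.+1) - A (x i)) - l | < eps.

Definition RS_integral (R : realType) (p q : R) (A f : R -> R) : R :=
  xget 0 [set l | is_RS_integral p q A f l].

Definition supnorm (R : realType) (p q : R) (f : R -> R) : R :=
  sup [set `|f x| | x in `[p, q]].

(* C([p,q],R): each continuous function on [p,q] is represented by its unique
   extension to R vanishing outside [p,q], so a functional on C([p,q],R) is the
   same thing as a function on this set. *)
Definition Cspace (R : realType) (p q : R) : set (R -> R) :=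
  [set f | {within `[p, q], continuous f} /\
           forall x, x \notin `[p, q] -> f x = 0].

(* The segment u_t, an element of Cspace (-r) 0. *)
Definition history (R : realType) (r : R) (u : R -> R) (t : R) : R -> R :=
  fun theta => if theta \in `[- r, 0] then u (t + theta) else 0.

Definition heaviside (R : realType) (tau : R) : R :=
  if 0 <= tau then 1 else 0.

Section problem.
Variables (R : realType) (r beta eta a b : R).
Variables (psi g A : R -> R) (F : R -> (R -> R) -> R).
Local Notation H := (@heaviside R).

Definition alpha (u : R -> R) : R := RS_integral 0 1 A u.

Definition gamma (t : R) : R := t / (beta + eta) * H t.

Definition kern (t s : R) : R :=
  (beta * t / (beta + eta) + t / (beta + eta) * (eta - s) * H (eta - s)
   - (t - s) * H (t - s)) * H t.

Definition Phi (s : R) : R :=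
  if 2^-1 <= beta + eta then s
  else (1 - (beta + eta)) / (beta + eta) * s.

Definition cconst : R :=
  if 2^-1 <= beta + eta
  then Num.min (a * beta / (beta + eta)) ((beta + eta - b) / (beta + eta))
  else Num.min (a * beta / (1 - (beta + eta)))
               ((beta + eta - b) / (1 - (beta + eta))).

Definition KA (s : R) : R := alpha (fun t => kern t s).

Definition psi_hyp : Prop :=
  {within `[- r, 1], continuous psi} /\ forall t, t \in `[0, 1] -> psi t = 0.

Definition g_hyp : Prop :=
  [/\ lebesgue_measurable `[0, 1] g,
      {ae leb, forall t : R, t \in `[0, 1] -> 0 <= g t} &
      leb.-integrable `[0, 1] (fun s : R => (g s * Phi s)%:E)].

(* F takes values in [0,+oo) and is an L^oo-Caratheodory functional. *)
Definition F_hyp : Prop :=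
  [/\ forall t phi, t \in `[0, 1] -> Cspace (- r) 0 phi -> 0 <= F t phi,
      forall phi, Cspace (- r) 0 phi ->
        lebesgue_measurable `[0, 1] (fun t => F t phi),
      {ae leb, forall t : R, t \in `[0, 1] ->
        forall phi, Cspace (- r) 0 phi ->
        forall eps : R, 0 < eps -> exists2 delta : R, 0 < delta &
        forall phi', Cspace (- r) 0 phi' ->
          supnorm (- r) 0 (phi' \- phi) < delta ->
          `|F t phi' - F t phi| < eps} &
      forall rad : R, 0 < rad -> exists vphi : R -> R,
        [/\ lebesgue_measurable `[0, 1] vphi,
            exists B : R,
              {ae leb, forall t : R, t \in `[0, 1] -> `|vphi t| <= B} &
            {ae leb, forall t : R, t \in `[0, 1] ->
              forall phi, Cspace (- r) 0 phi -> supnorm (- r) 0 phi <= rad ->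
                F t phi <= vphi t}]].

Definition A_hyp : Prop :=
  [/\ bounded_variation 0 1 A,
      {ae leb, forall s : R, s \in `[0, 1] -> 0 <= KA s} &
      0 <= alpha gamma < 1].

(* The constants below are extended reals: the supremum defining
   F^(-rho,rho) may be +oo. *)
Definition inv_m : \bar R :=
  ereal_sup [set (\int[leb]_(s in `[0%R, 1%R]) (`|kern t s| * g s)%:E
      + (`|gamma t| / (1 - alpha gamma))%:E
        * \int[leb]_(s in `[0%R, 1%R]) (KA s * g s)%:E)%E | t in `[0, 1]].

Definition inv_M : \bar R :=
  ereal_inf [set (\int[leb]_(s in `[(a + r)%R, b]) (kern t s * g s)%:E
      + (gamma t / (1 - alpha gamma))%:E
        * \int[leb]_(s in `[(a + r)%R, b]) (KA s * g s)%:E)%E | t in `[a, b]].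

Definition F_up (rho : R) : \bar R :=
  ereal_sup [set y | exists t phi,
    [/\ t \in `[0, 1], Cspace (- r) 0 phi, supnorm (- r) 0 phi <= rho &
        y = (F t phi / rho)%:E]].

Definition F_lo (rho : R) : \bar R :=
  ereal_inf [set y | exists t phi,
    [/\ t \in `[a, b], Cspace (- r) 0 phi,
        forall theta, theta \in `[- r, 0] -> rho <= phi theta <= rho / cconst &
        y = (F t phi / rho)%:E]].

Definition I1 (rho : R) : Prop :=
  supnorm (- r) 0 psi < rho /\ (F_up rho * inv_m < 1)%E.

Definition I0 (rho : R) : Prop := (1 < F_lo rho * inv_M)%E.

Definition S1 : Prop := exists rho1 rho2 : R,
  [/\ 0 < rho1 /\ 0 < rho2, supnorm (- r) 0 psi < rho2, rho1 / cconst < rho2,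
      I0 rho1 & I1 rho2].

Definition S2 : Prop := exists rho1 rho2 : R,
  [/\ 0 < rho1 /\ 0 < rho2, supnorm (- r) 0 psi < rho1, rho1 < rho2,
      I1 rho1 & I0 rho2].

(* Solutions of the boundary value problem are by definition solutions of the
   equivalent perturbed Hammerstein equation. Since Rintegral is total, the
   existence of the integral is made explicit. *)
Definition is_solution (u : R -> R) : Prop :=
  {within `[- r, 1], continuous u} /\
  forall t, t \in `[- r, 1] ->
    leb.-integrable `[0, 1]
      (fun s : R => (kern t s * g s * F s (history r u s))%:E) /\
    u t = psi t
          + \int[leb]_(s in `[0, 1]) (kern t s * g s * F s (history r u s))
          + gamma t * alpha u.

Definition nontrivial (u : R -> R) : Prop :=
  exists2 t, t \in `[- r, 1] & u t != psi t.

End problem.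

(* Main.v *)
(* Eliminating alpha[u], the problem becomes v = S v for the deviation v = u - psi, where
   S v (t) = int_0^1 G(t,s) g(s) F(s, u_s) ds with G(t,s) = k(t,s) + gamma(t) K_A(s) / (1 - alpha[gamma]).
   Since |k(t,s)| <= Phi(s) on [0,1], k(t,s) >= c Phi(s) for t in [a,b] and K_A >= 0, S takes values in the
   cone of the functions with min over [a,b] at least c times the sup norm.  The condition
   I^1_rho makes S contract the sphere of radius rho, I^0_rho makes S expand the set where the
   minimum over [a,b] is rho.  No fixed point index is used: S is discretized by piecewise
   linear functions, and in finite dimension the compressive case follows from the
   Poincare-Miranda theorem (itself a consequence of Kuhn's combinatorial lemma) applied to S
   composed with a retraction onto the annulus, while the expansive case is reduced to it by
   reversing the rays of the cone.  Equicontinuity of the range of S then yields a fixed point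
   as a uniform limit of the discrete ones. *)
Require Import Defs.
From mathcomp Require Import all_boot all_order all_algebra.
From mathcomp Require Import all_classical all_reals all_analysis.
From mathcomp Require Import measurable_realfun ring lra.

Set Implicit Arguments.
Unset Strict Implicit.
Unset Printing Implicit Defensive.

Import Order.TTheory GRing.Theory Num.Theory.
Import numFieldNormedType.Exports.
Local Open Scope classical_set_scope.
Local Open Scope ring_scope.

(** * Kuhn's lemma and the Poincare-Miranda theorem *)

(** The fixed point must not collapse to zero in the limit, so every estimate has to be uniform in
    the mesh. Sizes are therefore measured from below by the minimum over [[a, b]]: the lower bound
    obtained at the nodes of [[a, b]] is the same for all meshes, hence survives the limit and gives
    positivity and nontriviality at once. [I0] speaks only of histories with values in
    [[rho, rho / c]]; the cone supplies the upper end as soon as the minimum is [rho], and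
    integration over [[a + r, b]] keeps the delayed argument inside [[a, b]]. Since [g] is
    controlled only through [g * Phi], every domination is by a multiple of this weight. The
    Stieltjes functional is moved under the Lebesgue integral through sums over uniform grids: for
    these the interchange is linearity, and dominated convergence does the rest. Limits are needed
    at all times [t] simultaneously, so compactness is expressed by an ultrafilter. *)

Section cup_product.
Variables (n : nat) (V : Type) (up : 'I_n -> V -> V).
Hypothesis upC : forall i j v, up i (up j v) = up j (up i v).
Variable f : 'I_n -> V -> 'F_2.

(* [cup l J v] is the value, on the cube with lowest vertex [v] and directions [J], of the
   cup product over [l] of the coboundaries of the 0-cochains [f i], modulo 2. *)
Fixpoint cup (l : seq 'I_n) (J : {set 'I_n}) (v : V) : 'F_2 :=
  if l is i :: l' then
    \sum_(j in J) (f i (up j v) + f i v) * cup l' (J :\ j) (up j v)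
  else 1.

Lemma F2_addrr (x : 'F_2) : x + x = 0.
Proof. by apply: addrr_pchar2; exact: pchar_Fp. Qed.

(** Each unordered pair is counted twice, which is zero in characteristic 2. *)
Lemma sum_offdiag_sym (J : {set 'I_n}) (h : 'I_n -> 'I_n -> 'F_2) :
  (forall i j, h i j = h j i) ->
  \sum_(j in J) \sum_(i in J :\ j) h i j = 0.
Proof.
move=> hC.
rewrite (eq_bigr (fun j : 'I_n => \sum_(i in J | (i < j)%N) h i j
    + \sum_(i in J | (j < i)%N) h i j)); last first.
  move=> j _; rewrite (bigID (fun i : 'I_n => (i < j)%N))/=; congr (_ + _).
    by apply: eq_bigl => i; rewrite !inE -val_eqE/=; case: ltngtP; rewrite ?andbT ?andbF.
  by apply: eq_bigl => i; rewrite !inE -val_eqE/=; case: ltngtP; rewrite ?andbT ?andbF.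
rewrite big_split/= [X in _ + X](exchange_big_dep (mem J))/=; last first.
  by move=> ? ? _ /andP[].
rewrite -big_split/= big1// => j jJ;
  rewrite -[RHS](F2_addrr (\sum_(i in J | (i < j)%N) h i j)); congr (_ + _).
apply: eq_big => [i|i _]; last exact: hC.
by rewrite jJ.
Qed.

(* A cup product of coboundaries is a cocycle. *)
Lemma cup_closed (l : seq 'I_n) (J : {set 'I_n}) v :
  \sum_(j in J) (cup l (J :\ j) (up j v) + cup l (J :\ j) v) = 0.
Proof.
elim: l J v => [|k l IH] J v /=.
  by rewrite big1// => j _; exact: F2_addrr.
pose c i j w := cup l (J :\ j :\ i) w.
have cC i j w : c i j w = c j i w by rewrite /c !finset.setDDl finset.setUC.
transitivity (\sum_(j in J) \sum_(i in J :\ j)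
   (f k (up i (up j v)) * c i j (up i (up j v)) + f k (up j v) * c i j (up i (up j v))
    + (f k (up i v) * c i j (up i v) + f k v * c i j (up i v)))).
  by apply: eq_bigr => j jJ; rewrite -big_split; apply: eq_bigr => i iJ;
    rewrite /c !mulrDl.
pose S1 := \sum_(j in J) \sum_(i in J :\ j) f k (up i (up j v)) * c i j (up i (up j v)).
pose S2 := \sum_(j in J) \sum_(i in J :\ j) f k (up j v) * c i j (up i (up j v)).
pose S3 := \sum_(j in J) \sum_(i in J :\ j) f k (up i v) * c i j (up i v).
pose S4 := \sum_(j in J) \sum_(i in J :\ j) f k v * c i j (up i v).
transitivity (S1 + S2 + (S3 + S4)).
  rewrite /S1 /S2 /S3 /S4 -!big_split/=; apply: eq_bigr => j _.
  by rewrite -!big_split/=; apply: eq_bigr => i _.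
have swapE (h : 'I_n -> 'I_n -> 'F_2) :
    \sum_(j in J) \sum_(i in J :\ j) h i j = \sum_(j in J) \sum_(i in J :\ j) h j i.
  rewrite (exchange_big_dep (mem J))/=; last first.
    by move=> i j iJ; rewrite !inE => /andP[].
  apply: eq_bigr => j jJ; apply: eq_bigl => i.
  by rewrite !inE jJ andbT andbC eq_sym.
have -> : S1 = 0 by apply: sum_offdiag_sym => i j; rewrite upC cC.
have -> : S4 = 0.
  rewrite -(@sum_offdiag_sym J (fun i j => f k v * c i j v)); last first.
    by move=> i j; rewrite cC.
  apply: eq_bigr => j _; rewrite -!mulr_sumr; congr (_ * _).
  have := IH (J :\ j) v; rewrite big_split/= => /eqP.
  by rewrite addr_eq0 => /eqP ->; apply/eqP; rewrite eq_sym -addr_eq0 F2_addrr.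
have -> : S3 = \sum_(j in J) \sum_(i in J :\ j) f k (up j v) * c i j (up j v).
  rewrite /S3 swapE; apply: eq_bigr => j _; apply: eq_bigr => i _.
  by rewrite cC.
rewrite add0r addr0 /S2 -big_split/=; apply: big1 => j _.
rewrite -big_split/=; under eq_bigr => i _ do rewrite -mulrDr.
by rewrite -mulr_sumr IH mulr0.
Qed.

End cup_product.

Section kuhn_labelling.
Variables (n p : nat).
Local Notation V := {ffun 'I_n -> 'I_p.+1}.

(* Cyclic shift: being a bijection, it allows reindexing of sums over the whole grid. *)
Definition shift_coord (j : 'I_n) (v : V) : V :=
  [ffun i => if i == j then ordS (v i) else v i].
Local Notation up := shift_coord.

Lemma shift_coordC i j v : up i (up j v) = up j (up i v).
Proof. by apply/ffunP => k; rewrite !ffunE; case: (k == i); case: (k == j). Qed.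

Lemma shift_coord_inj j : injective (up j).
Proof.
move=> v w /ffunP e; apply/ffunP => k; have := e k; rewrite !ffunE.
by case: (k == j) => // /(bij_inj (@ordS_bij p.+1)).
Qed.

Variable f : 'I_n -> V -> 'F_2.
Hypothesis f0 : forall i (v : V), v i = 0%N :> nat -> f i v = 0.
Hypothesis f1 : forall i (v : V), v i = p :> nat -> f i v = 1.

(** A cube without the direction [i] stays in the face that contains [v]. There [f i] is constant,
    so its coboundary, one of the factors, vanishes. *)
Lemma cup_face (l : seq 'I_n) (J : {set 'I_n}) (v : V) (i : 'I_n) :
  i \in l -> i \notin J -> (v i = 0%N :> nat \/ v i = p :> nat) ->
  cup up f l J v = 0.
Proof.
elim: l J v => // k l IH J v; rewrite inE => /orP[/eqP <-|il] iJ vi /=.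
  apply: big1 => j jJ.
  have ij : (i == j) = false by apply: contraNF iJ => /eqP ->.
  have e : up j v i = v i by rewrite ffunE ij.
  case: vi => vi; first by rewrite !f0 ?e// addr0 mul0r.
  by rewrite !f1 ?e// F2_addrr mul0r.
apply: big1 => j jJ; rewrite IH ?mulr0//; first by rewrite !inE (negbTE iJ) andbF.
have ij : (i == j) = false by apply: contraNF iJ => /eqP ->.
by rewrite ffunE ij.
Qed.

(** The successor is cyclic, as in [shift_coord]; it is the true successor on the cubes of interest,
    where [v k < p]. *)
Definition in_cell (J : {set 'I_n}) (v y : V) : Prop :=
  forall k, y k = v k \/ (k \in J /\ y k = ordS (v k)).

(** A nonzero cup product has a nonzero term, that is, an edge path starting at [v] along which no
    coboundary factor vanishes; the edge used for [i] has endpoints with distinct labels. *)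
Lemma cup_neq0_labels (l : seq 'I_n) (J : {set 'I_n}) (v : V) :
  cup up f l J v != 0 -> forall i, i \in l ->
  exists y y', [/\ in_cell J v y, in_cell J v y' & f i y != f i y'].
Proof.
elim: l J v => // k l IH J v /= nz i.
have [j jJ] : exists2 j, j \in J &
    (f k (up j v) + f k v) * cup up f l (J :\ j) (up j v) != 0.
  apply/exists_inP; apply: contraNT nz; rewrite negb_exists_in => /forall_inP z.
  by apply/eqP; apply: big1 => j /z; rewrite negbK => /eqP.
rewrite mulf_eq0 negb_or => /andP[fn cn]; rewrite inE => /orP[/eqP ->|il].
  exists (up j v), v; split => [m|m|]; last 2 first.
  - by left.
  - by apply: contraNneq fn => ->; rewrite F2_addrr.
  by rewrite ffunE; case: eqP => [->|_]; [right|left].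
have lift y : in_cell (J :\ j) (up j v) y -> in_cell J v y.
  move=> hy m; have := hy m; rewrite !inE ffunE; case: eqP => [->|_] /= [->|[]//];
    last 2 first.
  - by left.
  - by move=> ? ->; right.
  by right.
have [y [y' [hy hy' fy]]] := IH _ _ cn i il.
by exists y, y'; split => //; exact: lift.
Qed.

(** Lowest vertices of the unit cubes with directions [J] in the face where all other coordinates
    equal [p]; the strict inequality leaves out the cubes that the cyclic shift would wrap
    around. *)
Definition box (J : {set 'I_n}) : pred V :=
  fun v => [forall i, if i \in J then (v i < p)%N else v i == p :> nat].

(** Telescoping in the direction [j]: reindexing by the cyclic shift turns the condition [v j != p]
    into [v j != 0], and modulo 2 the two sums differ by the layers [v j = p] and [v j = 0]. *)
Lemma sum_box_shift (J : {set 'I_n}) j (g : V -> 'F_2) : j \in J ->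
  \sum_(v | box J v) (g (up j v) + g v) =
  \sum_(v : V | box (J :\ j) v) g v + \sum_(v : V |
     (v j == 0%N :> nat) && [forall i,
       (i != j) ==> if i \in J then (v i < p)%N else v i == p :> nat]) g v.
Proof.
move=> jJ.
pose Q (v : V) :=
  [forall i, (i != j) ==> if i \in J then (v i < p)%N else v i == p :> nat].
have boxE v : box J v = Q v && (v j != p :> nat).
  apply/forallP/andP => [h|[/forallP h vj] i].
    split; first by apply/forallP => i; apply/implyP => _; exact: h.
    by have := h j; rewrite jJ; apply: contraTneq => ->; rewrite ltnn.
  have [->|ij] := eqVneq i j; last by have := h i; rewrite ij.
  by rewrite jJ ltn_neqAle vj -ltnS ltn_ord.
have box'E v : box (J :\ j) v = Q v && (v j == p :> nat).
  apply/forallP/andP => [h|[/forallP h vj] i].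
    split; last by have := h j; rewrite !inE eqxx.
    by apply/forallP => i; apply/implyP => ij; have := h i; rewrite !inE ij.
  have [->|ij] := eqVneq i j; first by rewrite !inE eqxx.
  by have := h i; rewrite !inE ij.
have QupE v : Q (up j v) = Q v.
  by apply: eq_forallb => i; rewrite ffunE; case: (i == j).
have up0 v : (up j v j == 0%N :> nat) = (v j == p :> nat).
  rewrite ffunE eqxx /=; have := ltn_ord (v j);
    rewrite ltnS leq_eqVlt => /orP[/eqP ->|vp].
    by rewrite modnn !eqxx.
  by rewrite modn_small//= (ltn_eqF vp).
rewrite big_split/=.
have -> : \sum_(v | box J v) g (up j v) = \sum_(v | Q v && (v j != 0%N :> nat)) g v.
  rewrite [RHS](reindex_inj (@shift_coord_inj j)); apply: eq_bigl => v.
  by rewrite boxE QupE up0.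
rewrite (eq_bigl _ _ boxE) (eq_bigl _ _ box'E).
have sp (P : pred V) : \sum_(v | Q v && ~~ P v) g v = \sum_(v | Q v) g v + \sum_(v | Q v && P v) g v.
  by rewrite [X in _ = X + _](bigID P)/= addrAC F2_addrr add0r.
rewrite !sp addrACA F2_addrr add0r addrC; congr (_ + _).
by apply: eq_bigl => v; rewrite andbC.
Qed.

(* Stokes: integrating [d (f i) cup ...] over the box leaves the faces of the box; those
   transverse to the direction [i] vanish by [cup_face], the face [v i = 0] by [f0], and on
   the face [v i = p] the factor [f i] is 1, so that [i] can be dropped. *)
Lemma sum_cup_box (l : seq 'I_n) : uniq l ->
  \sum_(v | box [set i in l] v) cup up f l [set i in l] v = 1.
Proof.
elim: l => [_|i l IH /= /andP[il ul]].
  rewrite (big_pred1 [ffun => ord_max])//= => v; apply/forallP/eqP => [h|-> i].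
    by apply/ffunP => i; apply/val_inj; rewrite ffunE; have := h i; rewrite inE => /eqP.
  by rewrite inE/= ffunE.
set J := [set k in i :: l].
have iJ : i \in J by rewrite !inE eqxx.
have Ji : J :\ i = [set k in l].
  by apply/setP => k; rewrite !inE; case: eqP => // ->; rewrite (negbTE il).
(* Leibniz rule: the correction is [f i v] times the coboundary of the shorter cup product, which is
   zero by [cup_closed]. The summand thus becomes a total difference in each direction [j]. *)
rewrite (eq_bigr (fun v => \sum_(j in J) (f i (up j v) * cup up f l (J :\ j) (up j v)
    + f i v * cup up f l (J :\ j) v))); last first.
  move=> v _; under eq_bigr => j _ do rewrite mulrDl.
  rewrite !big_split/=; congr (_ + _); apply/eqP; rewrite -subr_eq0 -sumrB.
  under eq_bigr => j _ do rewrite -mulrBr.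
  rewrite -mulr_sumr; have := cup_closed shift_coordC f l J v.
  move=> H; rewrite (_ : \sum_(j in J) _ = 0) ?mulr0// -[RHS]H; apply: eq_bigr => j _.
  by congr (_ + _); apply/eqP; rewrite eq_sym -addr_eq0 F2_addrr.
rewrite exchange_big/= (bigD1 i)//= [X in _ + X]big1 ?addr0; last first.
  move=> j /andP[jJ ji]; have jl : j \in l by move: jJ; rewrite !inE (negbTE ji).
  rewrite (sum_box_shift (fun v => f i v * cup up f l (J :\ j) v))//.
  rewrite !big1 ?addr0// => v.
    move=> /andP[/eqP vj _]; rewrite (@cup_face _ _ _ j) ?mulr0//; last by left.
    by rewrite !inE eqxx.
  move=> /forallP/(_ j); rewrite !inE eqxx/= => /eqP vj.
  by rewrite (@cup_face _ _ _ j) ?mulr0//; [rewrite !inE eqxx|right].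
rewrite (sum_box_shift (fun v => f i v * cup up f l (J :\ i) v))//
  [X in _ + X]big1 ?addr0.
  rewrite Ji -[RHS](IH ul); apply: eq_bigr => v /forallP/(_ i).
  by rewrite inE (negbTE il) => /eqP vi; rewrite f1// mul1r.
by move=> v /andP[/eqP vi _]; rewrite f0// mul0r.
Qed.

(** The cup products over all cells add up to 1 modulo 2, so one of them is nonzero, and such a cell
    carries both labels of every [f i]. *)
Lemma kuhn_cell : exists v : V, [/\ forall i, (v i < p)%N &
  forall i, exists y y' : V, [/\ forall k, (v k <= y k <= (v k).+1)%N,
    forall k, (v k <= y' k <= (v k).+1)%N, f i y = 0 & f i y' = 1]].
Proof.
have := sum_cup_box (enum_uniq 'I_n).
set J := [set i in _]; move=> /eqP S1.
have [v bv nz] : exists2 v, box J v & cup up f (enum 'I_n) J v != 0.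
  apply/exists_inP; apply: contraTT S1; rewrite negb_exists_in => /forall_inP z.
  by rewrite big1// => v /z; rewrite negbK => /eqP.
have vp i : (v i < p)%N by have := forallP bv i; rewrite !inE mem_enum inE.
exists v; split => // i.
have cell y : in_cell J v y -> forall k, (v k <= y k <= (v k).+1)%N.
  move=> h k; case: (h k) => [->|[_ ->]]; first by rewrite leqnn leqnSn.
  by rewrite /= modn_small ?ltnS ?vp// leqnSn leqnn.
have iE : i \in enum 'I_n by rewrite mem_enum.
have [y [y' [/cell hy /cell hy' ne]]] := cup_neq0_labels nz iE.
have F2E (x : 'F_2) : x = 0 \/ x = 1.
  case: x => -[|[|m]] //= lt; [left|right]; exact/val_inj.
case: (F2E (f i y)) (F2E (f i y')) ne => e [] e'; rewrite e e' ?eqxx// => _.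
- by exists y, y'.
- by exists y', y.
Qed.

End kuhn_labelling.

(** * Limits along a free ultrafilter *)

Lemma ultra_above_infty :
  exists U : set_system nat, UltraFilter U /\ (forall A, (\oo : set_system nat) A -> U A).
Proof.
by have [U [UU sU]] :=
  ultraFilterLemma (eventually_filter : ProperFilter (\oo : set_system nat)); exists U.
Qed.

(** One ultrafilter makes all bounded sequences converge together, which replaces diagonal
    extraction of subsequences. *)
Lemma ultra_cvg_bounded (R : realType) (U : set_system nat) (u : nat -> R) (M : R) :
  UltraFilter U -> (forall n, `|u n| <= M) ->
  exists2 l : R, `|l| <= M & u @ U --> l.
Proof.
move=> UU uM; have PU : ProperFilter U by exact: ultra_proper.
have : (u @ U) [set` `[- M, M]].
  by apply: (@filterE _ U) => n /=; rewrite in_itv/= -ler_norml.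
move=> /(@segment_compact R (- M) M (u @ U) _)[l [/=]].
rewrite in_itv/= -ler_norml => lM cl; exists l => //.
apply/cvgrPdist_lt => e e0.
have [//|Uc] := in_ultra_setVsetC [set n | `|l - u n| < e] UU.
have [|x [[n /= un <-] bx]] :=
  cl (u @` ~` [set n | `|l - u n| < e]) (ball l e) _ (nbhsx_ballx l e e0).
  by apply: (@filterS _ U _ _ _ _ Uc) => n un; exists n.
by exfalso; apply: un.
Qed.

Lemma cvg_dist_natSinv (R : realType) (u : nat -> R) (l C : R) :
  (forall k, `|u k - l| <= C / k.+1%:R) -> u @ \oo --> l.
Proof.
move=> uP; apply/cvgrPdistC_lt => e e0.
have C0 : 0 <= C by have := uP 0%N; rewrite divr1; apply: le_trans.
have H : (fun k => C * k.+1%:R^-1 : R) @ \oo --> 0.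
  by rewrite -(mulr0 C); apply: cvgMr; exact: cvg_harmonic.
near=> k; apply: (le_lt_trans (uP k)); apply: le_lt_trans (ler_norm _) _.
near: k.
exact: cvgr0_norm_lt.
Unshelve. all: by end_near. Qed.

Section poincare_miranda.
Variables (R : realType) (N : nat) (rad : R).
Hypothesis rad_gt0 : 0 < rad.
Local Notation vec := ('I_N -> R).
Let cube (x : vec) := forall i, `|x i| <= rad.
Variable h : vec -> vec.
Hypothesis h_cvg : forall (x_ : nat -> vec) x, (forall k, cube (x_ k)) -> cube x ->
  (forall i, x_ ^~ i @ \oo --> x i) -> forall i, (fun k => h (x_ k) i) @ \oo --> h x i.
Hypothesis h_lo : forall x i, cube x -> x i = - rad -> h x i <= 0.
Hypothesis h_hi : forall x i, cube x -> x i = rad -> 0 <= h x i.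

Let pt (p : nat) (v : 'I_N -> nat) : vec :=
  fun i => - rad + (2 * rad) * ((v i)%:R / p%:R).

Let pt_cube p v : (0 < p)%N -> (forall i, v i <= p)%N -> cube (pt p v).
Proof.
move=> p0 vp i; rewrite ler_norml /pt.
have p0' : 0 < p%:R :> R by rewrite ltr0n.
have q1 : (v i)%:R / p%:R <= 1 :> R by rewrite ler_pdivrMr// mul1r ler_nat.
have q0 : 0 <= (v i)%:R / p%:R :> R by rewrite divr_ge0.
move: q0 q1; set q := _ / _ => q0 q1.
have r0 := mulr_ge0 (ltW rad_gt0) q0.
have r1 : 0 <= rad * (1 - q) by rewrite mulr_ge0 ?subr_ge0// ltW.
by apply/andP; split; lra.
Qed.

(** Kuhn's lemma for the labels given by the signs of [h]: in some cell of side [2 * rad / p] every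
    component of [h] takes both weak signs. *)
Let approx_zero (p : nat) : (0 < p)%N -> exists X : vec, cube X /\
  forall i, exists Y Y' : vec, [/\ cube Y /\ cube Y',
    forall j, `|Y j - X j| <= 2 * rad / p%:R, forall j, `|Y' j - X j| <= 2 * rad / p%:R,
    h Y i <= 0 & 0 <= h Y' i].
Proof.
move=> p0.
pose ptf (w : {ffun 'I_N -> 'I_p.+1}) := pt p (fun i => w i : nat).
(* The labels on the faces are imposed before the sign is consulted: on the lower face [h] may
   vanish, and its sign would then give the wrong label 1. *)
pose f (i : 'I_N) (v : {ffun 'I_N -> 'I_p.+1}) : 'F_2 :=
  if v i == 0%N :> nat then 0 else if v i == p :> nat then 1 else
  if 0 <= h (ptf v) i then 1 else 0.
have f0 i (v : {ffun 'I_N -> 'I_p.+1}) : v i = 0%N :> nat ->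
  f i v = 0 by rewrite /f => ->.
have f1 i (v : {ffun 'I_N -> 'I_p.+1}) : v i = p :> nat -> f i v = 1.
  by move=> e; rewrite /f e eqxx eqn0Ngt p0.
have [v [vp H]] := kuhn_cell f0 f1.
have p0' : 0 < p%:R :> R by rewrite ltr0n.
exists (ptf v); split; first by apply: pt_cube => // i; exact: ltnW.
move=> i; have [y [y' [hy hy' fy fy']]] := H i.
have cy (w : {ffun 'I_N -> 'I_p.+1}) : cube (ptf w).
  by apply: pt_cube => // j; rewrite -ltnS.
have close (w : {ffun 'I_N -> 'I_p.+1}) :
    (forall k, v k <= w k <= (v k).+1)%N ->
      forall j, `|ptf w j - ptf v j| <= 2 * rad / p%:R.
  move=> hw j; rewrite /ptf /pt opprD addrACA subrr add0r -mulrBr -mulrBl mulrA.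
  rewrite normrM [X in _ * X]ger0_norm ?invr_ge0//.
  rewrite ler_pM2r ?invr_gt0// normrM ger0_norm; last by rewrite mulr_ge0// ltW.
  rewrite ger_pMr ?mulr_gt0//.
  have /andP[w1 w2] := hw j.
  by rewrite -natrB// ger0_norm// (ler_nat _ _ 1%N) leq_subLR addn1.
exists (ptf y), (ptf y'); split; [by split|exact: close|exact: close| |].
- move: fy; rewrite /f; case: eqP => [y0 _|_].
    by apply: h_lo => //; rewrite /ptf /pt y0 mul0r mulr0 addr0.
  by case: eqP => // _; case: ltP => // /ltW.
- move: fy'; rewrite /f; case: eqP => // _; case: eqP => [yp _|_].
    by apply: h_hi => //; rewrite /ptf /pt yp divff ?gt_eqF//; lra.
  by case: ifP.
Qed.

Lemma poincare_miranda : exists x, cube x /\ forall i, h x i = 0.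
Proof.
have /choice[X HX] : forall k : nat, exists X : vec, cube X /\
  forall i, exists Y Y' : vec, [/\ cube Y /\ cube Y',
    forall j, `|Y j - X j| <= 2 * rad / k.+1%:R, forall j,
      `|Y' j - X j| <= 2 * rad / k.+1%:R,
    h Y i <= 0 & 0 <= h Y' i].
  by move=> k; exact: approx_zero.
have [U [UU sU]] := ultra_above_infty.
have PU : ProperFilter U by exact: ultra_proper.
have /choice[x xP] : forall i, exists l : R, `|l| <= rad /\ (fun k => X k i) @ U --> l.
  by move=> i; have [l ? ?] := ultra_cvg_bounded UU (fun k => (HX k).1 i); exists l.
have cx : cube x by move=> i; exact: (xP i).1.
(* Continuity is assumed along sequences, so indices [s k >= k] with [X (s k)] tending to [x] at
   rate [1 / k.+1] are picked from the ultrafilter limit. The points of both signs then converge to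
   the same [x]. *)
have /choice[s sP] : forall k : nat, exists m : nat,
    (k <= m)%N /\ forall i, `|x i - X m i| < k.+1%:R^-1.
  move=> k; apply: (@filter_ex _ U); apply: filterI.
    by apply: sU; exact: nbhs_infty_ge.
  apply: filter_forall => i.
  by have /cvgrPdist_lt := (xP i).2; apply; rewrite invr_gt0.
exists x; split => // i.
have /choice[Y YP] : forall k, exists Y : vec, [/\ cube Y,
    (forall j, `|Y j - X (s k) j| <= 2 * rad / (s k).+1%:R) & h Y i <= 0].
  by move=> k; have [Y [Y' [[? ?] ? ? ? ?]]] := (HX (s k)).2 i; exists Y.
have /choice[Y' Y'P] : forall k, exists Y : vec, [/\ cube Y,
    (forall j, `|Y j - X (s k) j| <= 2 * rad / (s k).+1%:R) & 0 <= h Y i].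
  by move=> k; have [Y1 [Y1' [[? ?] ? ? ? ?]]] := (HX (s k)).2 i; exists Y1'.
have conv (Z : nat ->
  vec) : (forall k j, `|Z k j - X (s k) j| <= 2 * rad / (s k).+1%:R) ->
    forall j, Z ^~ j @ \oo --> x j.
  move=> ZP j; apply: (@cvg_dist_natSinv _ _ _ (2 * rad + 1)) => k.
  rewrite mulrDl mul1r (le_trans (ler_distD (X (s k) j) _ _))// lerD//.
    apply: le_trans (ZP k j) _;
      rewrite ler_pM2l ?mulr_gt0// lef_pV2 ?posrE// ler_nat ltnS.
    exact: (sP k).1.
  by rewrite distrC ltW//; exact: (sP k).2.
have hY : (fun k => h (Y k) i) @ \oo --> h x i.
  apply: h_cvg => //; first by move=> k; have [] := YP k.
  by apply: conv => k; have [] := YP k.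
have hY' : (fun k => h (Y' k) i) @ \oo --> h x i.
  apply: h_cvg => //; first by move=> k; have [] := Y'P k.
  by apply: conv => k; have [] := Y'P k.
apply/eqP; rewrite eq_le; apply/andP; split.
  rewrite -(cvg_lim (@Rhausdorff R) hY); apply: limr_le; first by apply/cvg_ex;
    eexists; exact: hY.
  by apply: nearW => k; have [] := YP k.
rewrite -(cvg_lim (@Rhausdorff R) hY'); apply: limr_ge; first by apply/cvg_ex; eexists;
  exact: hY'.
by apply: nearW => k; have [] := Y'P k.
Qed.

End poincare_miranda.

(** * Compression and expansion in a finite-dimensional cone *)

Section max_norm.
Variable R : realType.

Lemma cvg_maxr (u v : nat -> R) (l m : R) :
  u @ \oo --> l -> v @ \oo --> m -> (fun k => Num.max (u k) (v k)) @ \oo --> Num.max l m.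
Proof.
move=> ul vm; rewrite maxr_absE; under eq_fun do rewrite maxr_absE.
by apply: cvgMl; apply: cvgD; [exact: cvgD|apply: cvg_norm; exact: cvgB].
Qed.

Lemma cvg_minr (u v : nat -> R) (l m : R) :
  u @ \oo --> l -> v @ \oo --> m -> (fun k => Num.min (u k) (v k)) @ \oo --> Num.min l m.
Proof.
move=> ul vm; rewrite minr_absE; under eq_fun do rewrite minr_absE.
by apply: cvgMl; apply: cvgB; [exact: cvgD|apply: cvg_norm; exact: cvgB].
Qed.

Definition nrm (N : nat) (x : 'I_N -> R) : R := \big[Num.max/0]_(i < N) `|x i|.

Lemma nrm_ge0 N (x : 'I_N -> R) : 0 <= nrm x.
Proof. by rewrite /nrm; elim/big_ind: _ => // a b a0 b0; rewrite le_max a0. Qed.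

Lemma le_nrm N (x : 'I_N -> R) i : `|x i| <= nrm x.
Proof. exact: le_bigmax. Qed.

Lemma nrm_le N (x : 'I_N -> R) M : 0 <= M -> (forall i, `|x i| <= M) -> nrm x <= M.
Proof. by move=> M0 xM; apply/bigmax_leP; split. Qed.

Lemma cvg_nrm N (x_ : nat -> 'I_N -> R) x :
  (forall i, x_ ^~ i @ \oo --> x i) -> (fun k => nrm (x_ k)) @ \oo --> nrm x.
Proof.
move=> xx; rewrite /nrm; elim: (index_enum _) => [|i r IH].
  by under eq_fun do rewrite big_nil; rewrite big_nil; exact: cvg_cst.
under eq_fun do rewrite big_cons; rewrite big_cons.
by apply: cvg_maxr => //; exact: cvg_norm.
Qed.

End max_norm.

Section finite_cone.
Variables (R : realType) (N : nat) (I : pred 'I_N) (c : R).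
Hypotheses (c_gt0 : 0 < c) (c_le1 : c <= 1).
Local Notation vec := ('I_N -> R).

(** [I] stands for the nodes in [[a, b]]; the other coordinates may have any sign. *)
Definition in_cone (x : vec) := forall i j, I i -> c * `|x j| <= x i.

Lemma cone_ge0 x i : in_cone x -> I i -> 0 <= x i.
Proof. by move=> Kx Ii; apply: le_trans (Kx i i Ii); rewrite mulr_ge0// ltW. Qed.

Lemma cone_nrm x i : in_cone x -> I i -> c * nrm x <= x i.
Proof.
move=> Kx Ii; rewrite -ler_pdivlMl//; apply: nrm_le => [|j].
  by apply: mulr_ge0; [rewrite invr_ge0 ltW|exact: cone_ge0 Ii].
by rewrite ler_pdivlMl//; exact: Kx.
Qed.

Section compression.
Variables (d rad : R).
Hypotheses (d_gt0 : 0 < d) (d_rad : d < c * rad).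
(** The inner boundary is measured by the smallest coordinate in [I], the outer one by the maximum
    norm. As [d < c * rad], the cone keeps the two boundaries disjoint. *)
Definition in_annulus (x : vec) :=
  [/\ in_cone x, forall i, I i -> d <= x i & forall j, `|x j| <= rad].
Variable T : vec -> vec.
Hypothesis T_cone : forall x, in_annulus x -> in_cone (T x).
Hypothesis T_cvg : forall (x_ : nat -> vec) x, (forall k, in_annulus (x_ k)) ->
  in_annulus x ->
  (forall i, x_ ^~ i @ \oo --> x i) -> forall i, (fun k => T (x_ k) i) @ \oo --> T x i.
Hypothesis T_lo : forall x, in_annulus x -> (exists2 i, I i & x i = d) ->
  forall i, I i -> d < T x i.
Hypothesis T_hi : forall x, in_annulus x -> (exists j, `|x j| = rad) ->
  forall j, `|T x j| < rad.

Let rad_gt0 : 0 < rad.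
Proof. by rewrite -(pmulr_rgt0 _ c_gt0) (lt_trans d_gt0). Qed.

Let d_le_rad : d <= rad.
Proof. by apply: (le_trans (ltW d_rad)); rewrite ger_pMl. Qed.

(* [retr] retracts the cube of radius [rad] onto the annulus. *)
Let retr (x : vec) : vec := fun i =>
  if I i then Num.max (x i) (Num.max d (c * nrm x)) else x i.

(** Truncation makes [x - clamp (T (retr x))] satisfy the sign conditions on the faces of the cube,
    whatever [T] is. *)
Let clamp (z : R) := Num.max (- rad) (Num.min rad z).

(** Raising the coordinates in [I] to at least [d] and [c * nrm x] leaves the norm below the maximum
    of [nrm x] and [d]; since [c <= 1], the raised coordinates dominate [c] times this maximum. *)
Let retr_annulus x : (forall i, `|x i| <= rad) -> in_annulus (retr x).
Proof.
move=> cx; have nx : nrm x <= rad by apply: nrm_le => //; exact: ltW.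
have cn : c * nrm x <= nrm x by rewrite ler_piMl ?nrm_ge0.
have retrb j : `|retr x j| <= Num.max (nrm x) d.
  rewrite /retr; case: ifP => _; last by rewrite le_max le_nrm.
  rewrite ger0_norm; last by rewrite !le_max (ltW d_gt0) !orbT.
  rewrite !ge_max !le_max lexx cn (le_trans (ler_norm _) (le_nrm _ _))/=.
  by rewrite orbT.
split.
- move=> i j Ii; apply: (@le_trans _ _ (c * Num.max (nrm x) d)).
    by rewrite ler_pM2l//.
  rewrite /retr Ii maxr_pMr ?(ltW c_gt0)// ge_max !le_max lexx !orbT/=.
  by rewrite (_ : c * d <= d) ?orbT// ger_pMl.
- by move=> i Ii; rewrite /retr Ii !le_max lexx orbT.
- by move=> j; apply: le_trans (retrb j) _; rewrite ge_max nx d_le_rad.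
Qed.

Let clampb z : `|clamp z| <= rad.
Proof.
rewrite ler_norml /clamp le_max lexx/= ge_max ge_min lexx/= andbT.
by rewrite ge0_cp// ltW.
Qed.

(** A zero of [h] satisfies [x = clamp (T (retr x))], and neither the truncation nor the retraction
    turns out to be active. Truncation preserves the cone, so [x] lies in it; [T_lo] then excludes
    coordinates in [I] below [d], whence [retr x = x], and only now can [T_hi] be applied at [x] to
    exclude the truncation. *)
Lemma cone_compression : exists2 x, in_annulus x & T x = x.
Proof.
have cR := rad_gt0.
pose h (x : vec) : vec := fun i => x i - clamp (T (retr x) i).
have [|||x [cx hx]] := @poincare_miranda R N rad rad_gt0 h.
- move=> x_ x cx_ cx xx i; apply: cvgB; first exact: xx.
  apply: cvg_maxr; first exact: cvg_cst.
  apply: cvg_minr; first exact: cvg_cst.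
  apply: T_cvg => [k||j]; [exact: retr_annulus|exact: retr_annulus|].
  rewrite /retr; case: (I j); last exact: xx.
  apply: cvg_maxr; first exact: xx.
  apply: cvg_maxr; first exact: cvg_cst.
  by apply: cvgMr; exact: cvg_nrm.
- move=> x i cx xi; rewrite /h xi subr_le0.
  by have := clampb (T (retr x) i); rewrite ler_norml => /andP[].
- move=> x i cx xi; rewrite /h xi subr_ge0.
  by have := clampb (T (retr x) i); rewrite ler_norml => /andP[].
set w := retr x; have Dw : in_annulus w by exact: retr_annulus.
set z := T w; have Kz : in_cone z by exact: T_cone.
have clampE u : (`|u| <= rad /\ clamp u = u) \/ (rad < `|u| /\ `|clamp u| = rad).
  have [ur|ur] := leP `|u| rad; [left|right]; split=> //; rewrite /clamp.
    by move: ur; rewrite ler_norml => /andP[? ?]; rewrite min_r// max_r.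
  have [u0|u0] := ger0P u; move: ur; rewrite ?(ger0_norm u0) ?(ltr0_norm u0) => ur.
    by rewrite min_l ?(ltW ur)// max_r ?ger0_norm ?(ltW cR)//; lra.
  by rewrite min_r ?max_l ?normrN ?gtr0_norm//; lra.
have xz i : x i = clamp (z i) by apply/eqP; rewrite -subr_eq0; apply/eqP/hx.
have xzI i : I i -> x i = Num.min rad (z i).
  move=> Ii; have z0 := cone_ge0 Kz Ii; rewrite xz /clamp max_r// le_min.
  by apply/andP; split; lra.
have Kx : in_cone x.
  move=> i j Ii; rewrite [x i]xzI// le_min; apply/andP; split.
    by rewrite (le_trans _ (_ : c * rad <= _)) ?ler_pM2l// ger_pMl.
  apply: le_trans (Kz i j Ii); rewrite ler_pM2l// xz.
  by case: (clampE (z j)) => -[? ->] //; exact: ltW.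
have xd i : I i -> d <= x i.
  move=> Ii; rewrite leNgt; apply/negP => xid.
  (* As [x] is in the cone, [c * nrm x <= x i < d]: the retraction lifts this coordinate exactly to
     [d], where [T_lo] applies. *)
  have wi : w i = d.
    rewrite /w /retr Ii (max_l (_ : c * nrm x <= d)) ?max_r ?(ltW xid)//.
    by apply: (le_trans (cone_nrm Kx Ii)); exact: ltW.
  have zd := T_lo Dw (ex_intro2 _ _ i Ii wi) Ii.
  by move: xid; rewrite xzI// gt_min ltNge d_le_rad/= ltNge (ltW zd).
have xw : w = x.
  apply/funext => i; rewrite /w /retr; case: ifPn => // Ii.
  by rewrite max_l// ge_max xd//= cone_nrm.
have zrad j : `|z j| <= rad.
  rewrite leNgt; apply/negP => zj.
  have xj : `|x j| = rad.
    by rewrite xz; case: (clampE (z j)) => -[] //; rewrite leNgt zj.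
  have := T_hi Dw; rewrite xw => /(_ (ex_intro _ j xj) j).
  by rewrite -[T x]/(T x) -{1}xw -/z ltNge (ltW zj).
exists x; first by rewrite -xw.
apply/funext => j; rewrite xz -{1}xw -/z.
by case: (clampE (z j)) => -[] //; rewrite ltNge zrad.
Qed.
End compression.

Section expansion.
Variables (rho1 rho2 : R).
Hypotheses (rho1_gt0 : 0 < rho1) (rho12 : rho1 < rho2).
Variable S : vec -> vec.
Hypothesis S_cone : forall x, in_cone x -> in_cone (S x).
Hypothesis S_cvg : forall (x_ : nat -> vec) x, (forall k, in_cone (x_ k)) ->
  (forall k j, `|x_ k j| <= 2 * rho2 / c) -> in_cone x ->
  (forall i, x_ ^~ i @ \oo --> x i) -> forall i, (fun k => S (x_ k) i) @ \oo --> S x i.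
Hypothesis S_lo : forall x, in_cone x -> (forall j, `|x j| <= rho1) ->
  forall j, `|S x j| < rho1.
Hypothesis S_hi : forall x, in_cone x -> (forall i, I i -> rho2 <= x i) ->
  (exists2 i, I i & x i = rho2) -> forall i, I i -> rho2 < S x i.

(* The rays of the cone are reversed by [x |-> kap x *: x], which carries the outer
   sphere [nrm = rad] to [nrm = rho1] and fixes [low = rho2], so that conjugation
   by it turns the expansion [S] into a compression. *)
Let rad := 2 * rho2 / c.
Let slope := rho1 / rad.
(** The minimum of [x] over [I] when these coordinates are at most [rad], and [rad] for empty [I];
    written through [nrm] to inherit its continuity. *)
Let low (x : vec) := rad - nrm (fun i => if I i then rad - x i else 0).
(** Urysohn function of the two boundaries of the annulus: 0 on [low x = rho2], 1 on [nrm x = rad].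
    Accordingly [kap] runs from 1 to [slope]. *)
Let theta (x : vec) := (low x - rho2) / ((low x - rho2) + (rad - nrm x)).
Let kap (x : vec) := 1 - (1 - slope) * theta x.

Let rho2_gt0 : 0 < rho2. Proof. exact: lt_trans rho12. Qed.
Let c_rad : c * rad = 2 * rho2.
Proof. by rewrite /rad mulrC divfK// gt_eqF. Qed.
(** The factor 2 in [rad] makes this strict, which keeps the boundaries apart and the denominator of
    [theta] positive. *)
Let rho2_crad : rho2 < c * rad.
Proof. by rewrite c_rad; have := rho2_gt0; lra. Qed.
Let rad_ge : 2 * rho2 <= rad.
Proof. by rewrite -c_rad ler_piMl// /rad !mulr_ge0 ?invr_ge0// ltW. Qed.
Let rad_gt0 : 0 < rad.
Proof. by have := rad_ge; have := rho2_gt0; lra. Qed.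
Let slope_gt0 : 0 < slope.
Proof. by rewrite divr_gt0. Qed.
Let slope_le1 : slope <= 1.
Proof. by rewrite ler_pdivrMr// mul1r; have := rad_ge; have := rho12; have := rho1_gt0;
  lra. Qed.

Let low_le x i : I i -> low x <= x i.
Proof.
move=> Ii; rewrite /low; have := le_nrm (fun i => if I i then rad - x i else 0) i.
by rewrite Ii => h; have := ler_norm (rad - x i); lra.
Qed.

Let le_low x m : m <= rad -> (forall i, I i -> m <= x i <= rad) -> m <= low x.
Proof.
move=> mr xm; rewrite /low;
  suff : nrm (fun i => if I i then rad - x i else 0) <= rad - m by lra.
apply: nrm_le => [|i]; first lra.
case: ifP => [/xm/andP[? ?]|_]; last by rewrite normr0; lra.
by rewrite ger0_norm; lra.
Qed.

Let in_ann := in_annulus rho2 rad.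

Let low_bounds x : in_ann x -> rho2 <= low x /\ c * nrm x <= low x.
Proof.
move=> [Kx xr xR]; have xb i : I i -> x i <= rad by move=> _;
  exact: le_trans (ler_norm _) (xR i).
split; apply: le_low.
- by have := rad_ge; have := rho2_gt0; lra.
- by move=> i Ii; rewrite xr// xb.
- rewrite (le_trans (_ : _ <= nrm x)) ?ler_piMl ?nrm_ge0//.
  by apply: nrm_le => //; exact: ltW.
- by move=> i Ii; rewrite cone_nrm// xb.
Qed.

Let nrm_rad x : in_ann x -> nrm x <= rad.
Proof. by move=> [_ _ xR]; apply: nrm_le => //; exact: ltW. Qed.

Let den_gt0 x : in_ann x -> 0 < (low x - rho2) + (rad - nrm x).
Proof.
move=> Dx; have [l1 l2] := low_bounds Dx; have nr := nrm_rad Dx.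
have [nrr|nrr] := ltP (nrm x) rad; first by lra.
have e : nrm x = rad by apply/eqP; rewrite eq_le nr.
by rewrite e in l2 *; have := rho2_crad; lra.
Qed.

Let theta_itv x : in_ann x -> 0 <= theta x <= 1.
Proof.
move=> Dx; have [l1 l2] := low_bounds Dx; have nr := nrm_rad Dx; have d0 := den_gt0 Dx.
apply/andP; split; first by rewrite divr_ge0 ?(ltW d0)// subr_ge0.
by rewrite ler_pdivrMr// mul1r; lra.
Qed.

Let kap_itv x : in_ann x -> slope <= kap x <= 1.
Proof.
move=> Dx; have /andP[t0 t1] := theta_itv Dx; have s1 := slope_le1; rewrite /kap.
have h1 : 0 <= (1 - slope) * theta x by rewrite mulr_ge0// subr_ge0.
have h2 : 0 <= (1 - slope) * (1 - theta x) by rewrite mulr_ge0// subr_ge0.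
by apply/andP; split; lra.
Qed.

Let kap_gt0 x : in_ann x -> 0 < kap x.
Proof. by move=> /kap_itv/andP[+ _]; apply: lt_le_trans. Qed.

Let cone_scale a x : 0 <= a -> in_cone x -> in_cone (fun i => a * x i).
Proof.
move=> a0 Kx i j Ii; rewrite normrM (ger0_norm a0) mulrCA.
by apply: ler_wpM2l => //; exact: Kx.
Qed.

(** The conjugate [T x = (kap x)^-1 * S (kap x * x)] is compressive: on [low x = rho2] it coincides
    with [S], and on [nrm x = rad] the rescaled point has norm [rho1], where [S] contracts. A fixed
    point [x] of [T] gives the fixed point [kap x * x] of [S]; the lower bound is [slope * rho2],
    free of the dimension. *)
Lemma cone_expansion : exists x, [/\ in_cone x,
  forall i, I i -> rho1 / (2 * rho2 / c) * rho2 <= x i,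
  forall j, `|x j| <= 2 * rho2 / c & S x = x].
Proof.
pose sc (x : vec) : vec := fun i => kap x * x i.
pose T (x : vec) : vec := fun i => (kap x)^-1 * S (sc x) i.
have Ksc x : in_ann x -> in_cone (sc x).
  by move=> Dx; apply: cone_scale; [exact: ltW (kap_gt0 Dx)|case: Dx].
have sc_le x j : in_ann x -> `|sc x j| <= rad.
  move=> Dx; have /andP[_ k2] := kap_itv Dx; have [_ _ xR] := Dx.
  by rewrite /sc normrM gtr0_norm ?kap_gt0// (le_trans _ (xR j))// ler_piMl.
have [||||x Dx Tx] := @cone_compression rho2 rad rho2_gt0 rho2_crad T.
- move=> x Dx; apply: cone_scale; last exact: S_cone (Ksc _ Dx).
  by rewrite invr_ge0 ltW// kap_gt0.
- move=> x_ x Dx_ Dx xx i.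
  have kk : (fun k => kap (x_ k)) @ \oo --> kap x.
    have ll : (fun k => low (x_ k)) @ \oo --> low x.
      apply: cvgB; first exact: cvg_cst.
      apply: cvg_nrm => j; case: (I j); last exact: cvg_cst.
      by apply: cvgB; [exact: cvg_cst|exact: xx].
    have nn := cvg_nrm xx.
    apply: cvgB; first exact: cvg_cst.
    apply: cvgMr; apply: cvgM; first by apply: cvgB => //; exact: cvg_cst.
    apply: cvgV; first by rewrite gt_eqF// den_gt0.
    apply: cvgD; apply: cvgB => //; exact: cvg_cst.
  apply: cvgM; first by apply: cvgV => //; rewrite gt_eqF// kap_gt0.
  apply: (S_cvg (x_ := fun k => sc (x_ k))) => [k|k j||j].
  - exact: Ksc (Dx_ k).
  - exact: sc_le (Dx_ k).
  - exact: Ksc Dx.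
  - by apply: cvgM => //; exact: xx.
- move=> x Dx [i Ii xi] j Ij.
  have [Kx xr xR] := Dx.
  have k1 : kap x = 1.
    have e : low x = rho2.
      by apply/eqP; rewrite eq_le (low_bounds Dx).1 -{1}xi low_le.
    by rewrite /kap /theta e subrr mul0r mulr0 subr0.
  have scx : sc x = x by apply/funext => m; rewrite /sc k1 mul1r.
  by rewrite /T scx k1 invr1 mul1r; apply: S_hi => //; exists i.
- move=> x Dx [i xi] j.
  have nx : nrm x = rad by apply/eqP; rewrite eq_le nrm_rad//= -xi le_nrm.
  have kx : kap x = slope.
    have := den_gt0 Dx; rewrite nx subrr addr0 => d0.
    by rewrite /kap /theta nx subrr addr0 divff ?gt_eqF// mulr1; lra.
  rewrite /T normrM ger0_norm ?invr_ge0; last by rewrite ltW// kap_gt0.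
  rewrite kx ltr_pdivrMl// /slope divfK ?gt_eqF//; apply: S_lo; first exact: Ksc Dx.
  move=> m; rewrite /sc kx normrM gtr0_norm// -ler_pdivlMl//
    /slope invf_div divfK ?gt_eqF//.
  by case: Dx.
have [Kx xr xR] := Dx; have /andP[k1 k2] := kap_itv Dx.
exists (sc x); split.
- exact: Ksc Dx.
- move=> i Ii; rewrite /sc -/rad -/slope.
  by apply: ler_pM => //; [exact: ltW|exact: ltW|exact: xr].
- by move=> j; exact: sc_le Dx.
- apply/funext => i; have := congr1 (fun f => kap x * f i) Tx.
  by rewrite /T mulVKf// gt_eqF// kap_gt0.
Qed.
End expansion.
End finite_cone.

(** * Riemann-Stieltjes integrals of continuous functions *)

Lemma within_continuousP (R : realType) (A : set R) (f : R -> R) :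
  {within A, continuous f} <->
  forall x, A x -> forall e, 0 < e -> exists2 d, 0 < d &
    forall y, A y -> `|x - y| < d -> `|f x - f y| < e.
Proof.
split => [/subspace_continuousP H x Ax|H]; last (apply/subspace_continuousP => x Ax).
- move=> e e0; have /cvgrPdist_lt/(_ e e0) := H x Ax.
  by rewrite /within/= => /nbhs_ballP[d d0 dP]; exists d => // y Ay xy; exact: dP.
- apply/cvgrPdist_lt => e e0; have [d d0 dP] := H x Ax e e0.
by apply/nbhs_ballP; exists d => // y xy Ay; exact: dP.
Qed.

Lemma segment_unif_continuous (R : realType) (p q : R) (f : R -> R) :
  {within [set` `[p, q]], continuous f} -> forall e, 0 < e -> exists2 d, 0 < d &
  forall x y, x \in `[p, q] -> y \in `[p, q] -> `|x - y| < d -> `|f x - f y| < e.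
Proof.
move=> /within_continuousP cf e e0; apply: contrapT => H.
have {H} /choice[z zP] : forall k : nat, exists z : R * R,
    [/\ z.1 \in `[p, q], z.2 \in `[p, q],
      `|z.1 - z.2| < k.+1%:R^-1 & e <= `|f z.1 - f z.2|].
  move=> k; apply: contrapT => Hk; apply: H; exists k.+1%:R^-1; first by rewrite invr_gt0.
  move=> x y xpq ypq xy; rewrite ltNge; apply/negP => exy; apply: Hk.
  by exists (x, y).
have [U [UU sU]] := ultra_above_infty.
have PU : ProperFilter U by exact: ultra_proper.
have [|l _ zl] := @ultra_cvg_bounded R U (fun k => (z k).1) (`|p| + `|q|) UU.
  move=> k; have [+ _ _ _] := zP k; rewrite in_itv/= => /andP[zp zq].
  by have := normr_ge0 p; have := normr_ge0 q; have := ler_norm q; have :=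
    ler_norm (- p); rewrite normrN ler_norml => ? ? ? ?; apply/andP; split; lra.
have lpq : [set` `[p, q]] l.
  rewrite -(cvg_lim (@Rhausdorff R) zl) /= in_itv/=; apply/andP; split.
    apply: limr_ge; first by apply/cvg_ex; exists l.
    by apply: nearW => k; have [+ _ _ _] := zP k; rewrite in_itv/= => /andP[].
  apply: limr_le; first by apply/cvg_ex; exists l.
  by apply: nearW => k; have [+ _ _ _] := zP k; rewrite in_itv/= => /andP[].
have [d d0 dP] := cf l lpq (e / 2) (divr_gt0 e0 (ltr0n _ 2)).
have d20 : 0 < d / 2 by rewrite divr_gt0.
have /(@filter_ex _ U)[k [k1 k2]] : U [set k | `|l - (z k).1| < d / 2 /\ k.+1%:R^-1 < d / 2].
  apply: filterI; first by have /cvgrPdist_lt := zl; exact.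
  by apply: sU; exact: (near_infty_natSinv_lt (PosNum d20)).
have [z1 z2 z12 ez] := zP k.
have h1 : `|f l - f (z k).1| < e / 2 by apply: dP => //; lra.
have h2 : `|f l - f (z k).2| < e / 2.
  apply: dP => //; apply: (le_lt_trans (ler_distD (z k).1 _ _)).
  by rewrite [ltRHS]splitr ltrD// (lt_trans z12).
have := ler_distD (f l) (f (z k).1) (f (z k).2).
by rewrite (distrC (f (z k).1) (f l)); lra.
Qed.

Section riemann_stieltjes.
Variables (R : realType) (A : R -> R).
Hypothesis bvA : bounded_variation 0 1 A.

Definition cvar (x : R) : R := fine (total_variation 0 x A).

Lemma cvar_dist x y : 0 <= x -> x <= y -> y <= 1 -> `|A y - A x| <= cvar y - cvar x.
Proof.
move=> x0 xy y1; have y0 := le_trans x0 xy; have x1 := le_trans xy y1.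
have fy : total_variation 0 y A \is a fin_num.
  by apply/bounded_variationP => //; exact: bounded_variationl bvA.
have fx : total_variation 0 x A \is a fin_num.
  by apply/bounded_variationP => //; exact: bounded_variationl bvA.
have := total_variation_ge A xy.
have := total_variationD A x0 xy.
rewrite /cvar -lee_fin EFinB !fineK// => ->; rewrite addeAC subee// add0e.
by [].
Qed.

Let cl (lo hi z : R) := Num.max lo (Num.min hi z).

(** Both sides are the increment of [A] over the intersection of the two intervals, and zero when
    these are disjoint. *)
Lemma cell_swap lo hi lo' hi' : lo <= hi -> lo' <= hi' ->
  A (cl lo hi hi') - A (cl lo hi lo') = A (cl lo' hi' hi) - A (cl lo' hi' lo).
Proof.
move=> h h'; have [hl|hl] := leP lo hi'; have [lh|lh] := leP lo' hi; rewrite /cl.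
- rewrite (min_r lh) (min_r hl) (minC hi' hi) (maxC lo' lo).
  by rewrite (max_r (_ : lo <= _)) ?le_min ?h// (max_r (_ : lo' <= _)) ?le_min ?lh// maxC.
- rewrite (min_l (ltW lh)) (min_l (le_trans (ltW lh) h')) subrr.
  rewrite (min_r (le_trans (ltW lh) h')) (min_r hl) (max_l (ltW lh)).
  by rewrite max_l ?subrr// (le_trans h)// ltW.
- rewrite (min_r lh) (min_r (le_trans (ltW hl) h)) (min_l (le_trans (ltW hl) h)) (min_l (ltW hl)).
  by rewrite subrr (max_l (ltW hl)) max_l ?subrr// (le_trans h')// ltW.
- by exfalso; lra.
Qed.

Section two_partitions.
Variables (n m : nat) (f : R -> R) (x xi y zeta : nat -> R) (e d : R).
Hypotheses (x0 : x 0%N = 0) (xn : x n = 1) (y0 : y 0%N = 0) (ym : y m = 1).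
Hypothesis xiP : forall i, (i < n)%N -> x i.+1 - x i < d /\ x i <= xi i <= x i.+1.
Hypothesis zetaP : forall j, (j < m)%N -> y j.+1 - y j < d /\ y j <= zeta j <= y j.+1.
Hypothesis fP : forall s t, s \in `[0, 1] -> t \in `[0, 1] -> `|s - t| < d + d ->
  `|f s - f t| <= e.

Let incr_le (N : nat) (w : nat -> R) : (forall i, (i < N)%N -> w i <= w i.+1) ->
  forall i j, (i <= j)%N -> (j <= N)%N -> w i <= w j.
Proof.
move=> wS i; elim=> [|j IH]; first by rewrite leqn0 => /eqP ->.
rewrite leq_eqVlt => /predU1P[->//|ij] jN; apply: (le_trans (IH ij (ltnW jN))).
exact: wS.
Qed.

(* Both sums are split along the cells [x_i, x_(i+1)] cap [y_j, y_(j+1)]; clamping to a cell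
   makes the increments of [A] over these intersections telescope in either index. *)
Lemma tagged_sums_close :
  `|\sum_(0 <= i < n) f (xi i) * (A (x i.+1) - A (x i))
    - \sum_(0 <= j < m) f (zeta j) * (A (y j.+1) - A (y j))| <= e * (cvar 1 - cvar 0).
Proof.
have xS i : (i < n)%N -> x i <= x i.+1 by move=> /xiP[_ /andP[]]; exact: le_trans.
have yS i : (i < m)%N -> y i <= y i.+1 by move=> /zetaP[_ /andP[]]; exact: le_trans.
have xle := incr_le xS; have yle := incr_le yS.
have x01 i : (i <= n)%N -> 0 <= x i <= 1.
  by move=> i_n; rewrite -{1}x0 -xn !xle.
have y01 i : (i <= m)%N -> 0 <= y i <= 1.
  by move=> i_n; rewrite -{1}y0 -ym !yle.
pose c i j := cl (x i) (x i.+1) (y j).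
have c0 i : (i < n)%N -> c i 0%N = x i.
  move=> i_n; rewrite /c /cl y0; have /andP[p0 _] := x01 _ (ltnW i_n).
  by rewrite min_r ?max_l// (le_trans p0)// xS.
have cm i : (i < n)%N -> c i m = x i.+1.
  move=> i_n; rewrite /c /cl ym; have /andP[_ p0] := x01 _ i_n.
  by rewrite min_l ?max_r// xS.
have cS i j : (i < n)%N -> (j < m)%N -> c i j <= c i j.+1.
  move=> i_n jm; rewrite /c /cl ge_max le_max lexx/= le_max; apply/orP; right.
  by rewrite le_min !ge_min lexx yS// !orbT.
have c_ge i j : (i < n)%N -> x i <= c i j by move=> _; rewrite /c /cl le_max lexx.
have c_le i j : (i < n)%N -> c i j <= x i.+1.
  by move=> i_n; rewrite /c /cl ge_max xS//= ge_min lexx.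
have -> : \sum_(0 <= i < n) f (xi i) * (A (x i.+1) - A (x i)) =
    \sum_(0 <= i < n) \sum_(0 <= j < m) f (xi i) * (A (c i j.+1) - A (c i j)).
  apply: eq_big_nat => i /andP[_ i_n]; rewrite -mulr_sumr; congr (_ * _).
  by rewrite (telescope_sumr (fun j => A (c i j)))// c0// cm.
pose c' i j := cl (y j) (y j.+1) (x i).
have -> : \sum_(0 <= j < m) f (zeta j) * (A (y j.+1) - A (y j)) =
    \sum_(0 <= i < n) \sum_(0 <= j < m) f (zeta j) * (A (c i j.+1) - A (c i j)).
  rewrite exchange_big_nat/=; apply: eq_big_nat => j /andP[_ jm].
  rewrite -mulr_sumr; congr (_ * _).
  transitivity (\sum_(0 <= i < n) (A (c' i.+1 j) - A (c' i j))).
    rewrite (telescope_sumr (fun i => A (c' i j)))// /c' /cl x0 xn.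
    have /andP[p0 _] := y01 _ (ltnW jm); have /andP[_ p1] := y01 _ jm.
    have yj := yS _ jm.
    by rewrite (min_l p1) (max_r yj) (min_r (le_trans p0 yj)) max_l.
  apply: eq_big_nat => i /andP[_ i_n]; symmetry.
  by apply: cell_swap; [exact: xS|exact: yS].
rewrite -sumrB (le_trans (ler_norm_sum _ _ _))//.
have -> : e * (cvar 1 - cvar 0) =
    \sum_(0 <= i < n) \sum_(0 <= j < m) e * (cvar (c i j.+1) - cvar (c i j)).
  transitivity (e * (cvar (x n) - cvar (x 0%N))); first by rewrite x0 xn.
  rewrite -(telescope_sumr (fun i => cvar (x i)))// mulr_sumr.
  apply: eq_big_nat => i /andP[_ i_n]; rewrite -mulr_sumr; congr (_ * _).
  by rewrite (telescope_sumr (fun j => cvar (c i j)))// c0// cm.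
apply: ler_sum_nat => i /andP[_ i_n].
rewrite -sumrB (le_trans (ler_norm_sum _ _ _))//.
apply: ler_sum_nat => j /andP[_ jm].
rewrite -mulrBl normrM.
have /andP[xi0 _] := x01 _ (ltnW i_n); have /andP[_ xi1] := x01 _ i_n.
have /andP[yj0 _] := y01 _ (ltnW jm); have /andP[_ yj1] := y01 _ jm.
have Ac : `|A (c i j.+1) - A (c i j)| <= cvar (c i j.+1) - cvar (c i j).
  apply: cvar_dist;
    [exact: le_trans (c_ge _ _ i_n)|exact: cS|exact: le_trans (c_le _ _ i_n) xi1].
have [mx /andP[tx1 tx2]] := xiP i_n; have [my /andP[ty1 ty2]] := zetaP jm.
have e0 : 0 <= e by have := fP (s := 0) (t := 0);
  rewrite subrr normr0 subrr normr0 in_itv/= lexx ler01; apply => //; lra.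
(* Cells that do not meet have zero clamped increment; cells that meet have tags less than [d + d]
   apart. *)
have [ov1|ov1] := leP (x i) (y j.+1); last first.
  have e1 z : z <= x i -> cl (x i) (x i.+1) z = x i.
    by move=> zx; rewrite /cl min_r ?max_l// (le_trans zx)// xS.
  have e2 := le_trans (yS _ jm) (ltW ov1).
  by rewrite /c (e1 _ (ltW ov1)) (e1 _ e2) !subrr normr0 !mulr0.
have [ov2|ov2] := leP (y j) (x i.+1); last first.
  have e1 z : x i.+1 <= z -> cl (x i) (x i.+1) z = x i.+1.
    by move=> zx; rewrite /cl min_l ?max_r// xS.
  have e2 := le_trans (ltW ov2) (yS _ jm).
  by rewrite /c (e1 _ (ltW ov2)) (e1 _ e2) !subrr normr0 !mulr0.
apply: ler_pM => //; apply: fP; rewrite ?in_itv/=.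
- by apply/andP; split; lra.
- by apply/andP; split; lra.
- by rewrite ltr_norml; apply/andP; split; lra.
Qed.
End two_partitions.

(** Stieltjes sum on the uniform grid with left tags: a fixed sequence of finite sums through which
    measurability and interchange of integrals are obtained. *)
Definition usum (f : R -> R) (n : nat) : R :=
  \sum_(0 <= i < n) f (i%:R / n%:R) * (A (i.+1%:R / n%:R) - A (i%:R / n%:R)).

Let grid_step (n i : nat) : (0 < n)%N -> i.+1%:R / n%:R - i%:R / n%:R = n%:R^-1 :> R.
Proof. by move=> n0; rewrite -mulrBl -natr1 addrAC subrr add0r mul1r. Qed.

Let grid_tag (n i : nat) (d : R) : (0 < n)%N -> n%:R^-1 < d ->
  let z j : R := j%:R / n%:R in z i.+1 - z i < d /\ z i <= z i <= z i.+1.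
Proof.
move=> n0 nd z; rewrite /z grid_step//; split => //; rewrite lexx/=.
by rewrite -subr_ge0 grid_step.
Qed.

Let cvar01 : 0 <= cvar 1 - cvar 0.
Proof. by rewrite (le_trans _ (@cvar_dist 0 1 _ _ _)). Qed.

(** [RS_integral] is a chosen value, meaningful only once some value exists. Closeness of fine
    tagged sums makes the uniform sums Cauchy and their limit a Stieltjes integral; the chosen value
    is then one too, and the uniform grids, being admissible partitions, converge to it. *)
Lemma usum_cvg (f : R -> R) : {within [set` `[0, 1]], continuous f} ->
  (fun k => usum f k.+1) @ \oo --> RS_integral 0 1 A f.
Proof.
move=> cf; have cV := cvar01; set V := cvar 1 - cvar 0 in cV.
have unif e : 0 < e -> exists2 d, 0 < d & forall (n : nat) (x xi : nat -> R) (k : nat),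
    x 0%N = 0 -> x n = 1 ->
    (forall i, (i < n)%N -> x i.+1 - x i < d /\ x i <= xi i <= x i.+1) ->
    k.+1%:R^-1 < d ->
    `|\sum_(0 <= i < n) f (xi i) * (A (x i.+1) - A (x i)) - usum f k.+1| < e.
  (* The variation [V] may be zero, hence the denominator [V + 1]. *)
  move=> e0; have e'0 : 0 < e / (V + 1) by rewrite divr_gt0// ltr_wpDl.
  have [d d0 dP] := segment_unif_continuous cf e'0.
  exists (d / 2) => [|n x xi k x0 xn xP kd]; first by rewrite divr_gt0.
  apply: (@le_lt_trans _ _ (e / (V + 1) * V)).
    apply: (@tagged_sums_close n k.+1 f x xi (fun i => i%:R / k.+1%:R)
      (fun i => i%:R / k.+1%:R) (e / (V + 1)) (d / 2)) => //.
    - by rewrite mul0r.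
    - by rewrite divff// pnatr_eq0.
    - by move=> j _; exact: grid_tag.
    - by move=> s t s01 t01; rewrite -splitr => st; rewrite ltW// dP.
  by rewrite mulrAC ltr_pdivrMr ?ltr_wpDl// ltr_pM2l// ltrDl.
have [l ul] : exists l : R, (fun k => usum f k.+1) @ \oo --> l.
  apply/cvg_ex/cauchy_cvgP/cauchy_exP => e e0.
  have [d d0 dP] := unif e e0.
  have [k' /= k'd] :=
    @filter_ex _ (\oo : set_system nat) _ _ (near_infty_natSinv_lt (PosNum d0)).
  exists (usum f k'.+1); near=> k; rewrite -ball_normE/= {1}/usum.
  apply: (dP k'.+1 (fun i => i%:R / k'.+1%:R) (fun i => i%:R / k'.+1%:R)) => //.
  - by rewrite mul0r.
  - by rewrite divff// pnatr_eq0.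
  - by move=> i _; exact: grid_tag.
  - by near: k; exact: (near_infty_natSinv_lt (PosNum d0)).
have RSl : is_RS_integral 0 1 A f l.
  move=> e e0; have e20 : 0 < e / 2 by rewrite divr_gt0.
  have [d d0 dP] := unif _ e20; exists d => // s xi sP x xP.
  have [k [k1 k2]] : exists k, k.+1%:R^-1 < d /\ `|usum f k.+1 - l| < e / 2.
    apply: (@filter_ex _ (\oo : set_system nat)).
    apply: filterI; first exact: (near_infty_natSinv_lt (PosNum d0)).
    by have /cvgrPdistC_lt := ul; exact.
  apply: (le_lt_trans (ler_distD (usum f k.+1) _ _)); rewrite [ltRHS]splitr ltrD//.
  by apply: dP => //; exact: itv_partition_nth_size sP.
have RSI : is_RS_integral 0 1 A f (RS_integral 0 1 A f).
  by apply: (xgetPex 0 (P := [set l | is_RS_integral 0 1 A f l])); exists l.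
apply/cvgrPdistC_lt => e e0; have [d d0 dP] := RSI e e0.
near=> k.
pose s := mkseq (fun i => i.+1%:R / k.+1%:R : R) k.+1.
have sE i : (i <= k.+1)%N -> nth 1 (0 :: s) i = i%:R / k.+1%:R.
  case: i => [|i]; first by rewrite mul0r.
  by move=> ik /=; rewrite nth_mkseq.
have sP : itv_partition 0 1 s.
  split.
    apply/(pathP 1) => i; rewrite size_mkseq => ik.
    have := sE i (ltnW ik); rewrite nth_mkseq// => ->.
    by rewrite ltr_pM2r ?invr_gt0// ltr_nat.
  by rewrite (last_nth 1) size_mkseq sE// divff// pnatr_eq0.
have := dP s (fun i => i%:R / k.+1%:R) sP; rewrite size_mkseq.
rewrite /usum (@eq_big_nat _ _ _ _ _ (fun i => f (i%:R / k.+1%:R) *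
   (A (nth 1 (0 :: s) i.+1) - A (nth 1 (0 :: s) i)))
   (fun i => f (i%:R / k.+1%:R) * (A (i.+1%:R / k.+1%:R) - A (i%:R / k.+1%:R))));
     last first.
  by move=> i /andP[_ ik]; rewrite !sE// ltnW.
apply=> i ik; rewrite !sE//; last exact: ltnW.
apply: grid_tag => //; near: k; exact: (near_infty_natSinv_lt (PosNum d0)).
Unshelve. all: by end_near. Qed.

Lemma usum_le (f : R -> R) (M : R) (k : nat) : (forall t, t \in `[0, 1] -> `|f t| <= M) ->
  `|usum f k.+1| <= M * (cvar 1 - cvar 0).
Proof.
move=> fM; rewrite /usum (le_trans (ler_norm_sum _ _ _))//.
have -> : M * (cvar 1 - cvar 0) =
    \sum_(0 <= i < k.+1) M * (cvar (i.+1%:R / k.+1%:R) - cvar (i%:R / k.+1%:R)).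
  rewrite -mulr_sumr (telescope_sumr (fun i => cvar (i%:R / k.+1%:R)))//.
  by rewrite mul0r divff// pnatr_eq0.
have g01 i : (i <= k.+1)%N -> 0 <= (i%:R / k.+1%:R : R) <= 1.
  by move=> ik; rewrite divr_ge0//= ler_pdivrMr// mul1r ler_nat.
apply: ler_sum_nat => i /andP[_ ik]; rewrite normrM ler_pM//.
  by apply: fM; rewrite in_itv/= g01// ltnW.
have /andP[? _] := g01 i (ltnW ik); have /andP[_ ?] := g01 _ ik.
by apply: cvar_dist => //; rewrite ler_pM2r ?invr_gt0// ler_nat.
Qed.

End riemann_stieltjes.

(** * Integration with respect to a complete measure *)

Section complete_measure.
Context d (T : measurableType d) (R : realType) (mu : {measure set T -> \bar R}).
Hypothesis cmu : measure_is_complete mu.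
Variables (D : set T).
Hypothesis mD : measurable D.

(** The upper limit is measurable and agrees with [f] almost everywhere; completeness transfers
    measurability to [f]. *)
Lemma ae_cvg_measurable (f_ : nat -> T -> R) (f : T -> R) :
  (forall n, measurable_fun D (f_ n)) ->
  {ae mu, forall x, D x -> f_ ^~ x @ \oo --> f x} -> measurable_fun D f.
Proof.
move=> mf ff; apply/measurable_EFinP.
apply: (ae_measurable_fun cmu (f := fun x => limn_esup (fun n => (f_ n x)%:E))).
  apply: filterS ff => x fx Dx /=; have {}fx := fx Dx.
  have h : (fun n => (f_ n x)%:E) @ \oo --> (f x)%:E by apply/fine_cvgP; split => //;
    exact: nearW.
  by rewrite is_cvg_limn_esupE; [exact: cvg_lim|apply/cvg_ex; eexists; exact: h].
by apply: measurable_fun_limn_esup => n; exact/measurable_EFinP.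
Qed.

Lemma ae_le_integrable (f h : T -> R) : measurable_fun D f ->
  mu.-integrable D (EFin \o h) -> {ae mu, forall x, D x -> `|f x| <= h x} ->
  mu.-integrable D (EFin \o f).
Proof.
move=> mf /integrableP[mh hoo] fh; apply/integrableP; split.
  exact/measurable_EFinP.
apply: le_lt_trans hoo; apply: ae_ge0_le_integral => //.
- by apply: measurableT_comp => //; exact/measurable_EFinP.
- by apply: measurableT_comp.
- apply: filterS fh => x fhx Dx; rewrite /= lee_fin (le_trans (fhx Dx))//.
  exact: ler_norm.
Qed.

Lemma ae_le_Rintegral (f g : T -> R) :
  mu.-integrable D (EFin \o f) -> mu.-integrable D (EFin \o g) ->
  {ae mu, forall x, D x -> f x <= g x} ->
  \int[mu]_(x in D) f x <= \int[mu]_(x in D) g x.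
Proof.
move=> fi gi fg; rewrite -subr_ge0 -RintegralB//.
rewrite /Rintegral fine_ge0//.
have mfg : measurable_fun D (fun x => (g x - f x)%:E).
  apply/measurable_EFinP; apply: measurable_funB; apply/measurable_EFinP;
    exact: (measurable_int mu).
rewrite [leRHS](@ae_eq_integral _ _ _ _ _ (fun x => `|(g x - f x)%:E|)%E)//.
- by apply: integral_ge0 => x _; exact: abse_ge0.
- by apply: measurableT_comp.
- by apply: filterS fg => x fgx Dx; rewrite /= ger0_norm// subr_ge0 fgx.
Qed.

Lemma ae_Rintegral_ge0 (f : T -> R) : mu.-integrable D (EFin \o f) ->
  {ae mu, forall x, D x -> 0 <= f x} -> 0 <= \int[mu]_(x in D) f x.
Proof.
move=> fi f0; apply: (le_trans _ (@ae_le_Rintegral (fun=> 0) f _ fi f0)).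
  by rewrite /Rintegral integral0.
exact: integrable0.
Qed.

Lemma ae_norm_Rintegral_le (f h : T -> R) : measurable_fun D f ->
  mu.-integrable D (EFin \o h) -> {ae mu, forall x, D x -> `|f x| <= h x} ->
  `|\int[mu]_(x in D) f x| <= \int[mu]_(x in D) h x.
Proof.
move=> mf hi fh; have fi := ae_le_integrable mf hi fh.
apply: (le_trans (le_normr_Rintegral mD fi)); apply: ae_le_Rintegral => //.
by have := integrable_abse fi.
Qed.

Lemma Rintegral_dominated_cvg (f_ : nat -> T -> R) (f h : T -> R) :
  (forall n, measurable_fun D (f_ n)) ->
  {ae mu, forall x, D x -> f_ ^~ x @ \oo --> f x} ->
  mu.-integrable D (EFin \o h) ->
  {ae mu, forall x, D x -> forall n, `|f_ n x| <= h x} ->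
  mu.-integrable D (EFin \o f) /\
  (fun n => \int[mu]_(x in D) f_ n x) @ \oo --> \int[mu]_(x in D) f x.
Proof.
move=> mf ff hi fh; have mF := ae_cvg_measurable mf ff.
have [||||| fi _ c] :=
  @dominated_convergence _ _ _ mu D mD (fun n => EFin \o f_ n) (EFin \o f) (EFin \o h).
- by move=> n; exact/measurable_EFinP.
- exact/measurable_EFinP.
- by apply: filterS ff => x fx Dx /=; apply/fine_cvgP; split; [exact: nearW|exact: fx].
- exact: hi.
- by apply: filterS fh => x fx n Dx /=; rewrite lee_fin fx.
split => //; apply: fine_cvg; rewrite fineK//.
exact: integrable_fin_num.
Qed.

End complete_measure.

(** * The Green's function *)

Section kernel.
Variables (R : realType) (beta eta a b : R).
Hypotheses (beta_gt0 : 0 < beta) (eta_gt0 : 0 < eta) (be_le1 : beta + eta <= 1).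
Hypotheses (a_gt0 : 0 < a) (a_lt_b : a < b) (b_lt_be : b < beta + eta).
Local Notation k := (kern beta eta).
Local Notation Ph := (Phi beta eta).
Local Notation ga := (gamma beta eta).
Local Notation c := (cconst beta eta a b).

Lemma mul_heaviside (x : R) : x * heaviside x = Num.max x 0.
Proof.
rewrite /heaviside; case: ifPn => [x0|]; first by rewrite mulr1 max_l.
by rewrite -ltNge => x0; rewrite mulr0 max_r// ltW.
Qed.

Lemma kernE t s : k t s = (beta * t / (beta + eta) + t / (beta + eta) * Num.max (eta - s) 0
  - Num.max (t - s) 0) * heaviside t.
Proof. by rewrite /kern -!mulrA !mul_heaviside. Qed.

Lemma heaviside_ge0 (t : R) : 0 <= t -> heaviside t = 1.
Proof. by rewrite /heaviside => ->. Qed.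

Lemma heaviside_lt0 (t : R) : t < 0 -> heaviside t = 0.
Proof. by rewrite /heaviside ltNge => /negbTE ->. Qed.

Lemma gammaE t : 0 <= t -> ga t = t / (beta + eta).
Proof. by move=> t0; rewrite /gamma heaviside_ge0// mulr1. Qed.

Let be_gt0 : 0 < beta + eta. Proof. exact: addr_gt0. Qed.

Lemma Phi_ge0 s : 0 <= s -> 0 <= Ph s.
Proof.
by move=> s0; rewrite /Phi; case: ifP => // _;
  rewrite mulr_ge0// divr_ge0 ?subr_ge0// ltW.
Qed.

Let kern_cases t s : 0 <= t -> let q := t / (beta + eta) in
  k t s = beta * q + q * Num.max (eta - s) 0 - Num.max (t - s) 0.
Proof. by move=> t0 q; rewrite kernE heaviside_ge0// mulr1 mulrA. Qed.

(** Put [u = 1 / (beta + eta)] and [q = t * u]. In each of the four positions of [s] relative to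
    [eta] and [t], the kernel is at most [s]; its most negative value comes from [s * (1 - q)] with
    [q <= u], so it is at least [- (u - 1) * s] or nonnegative. *)
Lemma kern_le t s : 0 <= t <= 1 -> 0 <= s <= 1 -> `|k t s| <= Ph s.
Proof.
have B0 := beta_gt0; have E0 := eta_gt0; have BE := be_le1.
move=> /andP[t0 t1] /andP[s0 s1]; rewrite kern_cases//; set q := t / _.
set u := (beta + eta)^-1.
have u1 : 1 <= u by rewrite invf_ge1.
have ub : u * (beta + eta) = 1 by rewrite mulVf// gt_eqF.
have qE : q = t * u by [].
have qb : q * (beta + eta) = t by rewrite qE -mulrA ub mulr1.
have q0 : 0 <= q by rewrite divr_ge0// ltW.
have qu : q <= u by rewrite qE ler_piMl// invr_ge0 ltW.
have u0 : 0 <= u by rewrite (le_trans ler01).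
(* The two cases of [Phi] are the two cases of the maximum of [1] and [u - 1], which are equal at
   [beta + eta = 1/2]. *)
have [Pc -> /andP[P1 Pu]] : exists2 Pc, Ph s = Pc * s & (1 <= Pc) && (u - 1 <= Pc).
  rewrite /Phi; case: ifPn => [h|].
    exists 1; first by rewrite mul1r.
    rewrite lexx/=.
    have : 0 <= u * (beta + eta - 2^-1) by rewrite mulr_ge0// subr_ge0.
    by move: ub; rewrite mulrBr; lra.
  rewrite -ltNge => h; exists ((1 - (beta + eta)) / (beta + eta)) => //.
  rewrite mulrBl mul1r divff ?gt_eqF// -/u lexx andbT.
  have : 0 <= u * (2^-1 - (beta + eta)) by rewrite mulr_ge0// subr_ge0 ltW.
  by move: ub; rewrite mulrBr; lra.
have Ps : s <= Pc * s by rewrite ler_peMl.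
have usPs : (u - 1) * s <= Pc * s by rewrite ler_wpM2r.
have [se|se] := leP s eta.
  rewrite max_l ?subr_ge0//; have [st|st] := leP s t.
    rewrite max_l ?subr_ge0//.
    have -> : beta * q + q * (eta - s) - (t - s) = s * (1 - q) by rewrite -qb; ring.
    rewrite ler_norml; apply/andP; split.
      have : 0 <= s * (u - q) by rewrite mulr_ge0// subr_ge0.
      by lra.
    by have h := mulr_ge0 s0 q0; lra.
  rewrite max_r; last by rewrite subr_le0 ltW.
  have -> : beta * q + q * (eta - s) - 0 = t - q * s by rewrite -qb; ring.
  rewrite ler_norml; apply/andP; split; last first.
    by have h := mulr_ge0 q0 s0; lra.
  have : 0 <= q * (beta + eta - s) by rewrite mulr_ge0//; lra.
  by rewrite mulrBr qb; lra.
rewrite max_r; last by rewrite subr_le0 ltW.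
have bq0 : 0 <= beta * q by rewrite mulr_ge0// ltW.
have eq0 : 0 <= eta * q by rewrite mulr_ge0// ltW.
have [st|st] := leP s t.
  rewrite max_l ?subr_ge0//.
  have -> : beta * q + q * 0 - (t - s) = s - eta * q by rewrite -qb; ring.
  rewrite ler_norml; apply/andP; split; last by lra.
  have h1 : 0 <= (s - eta) * q by rewrite mulr_ge0// subr_ge0 ltW.
  have h2 : 0 <= s * (u - q) by rewrite mulr_ge0// subr_ge0.
  by move: h1 h2; lra.
rewrite max_r; last by rewrite subr_le0 ltW.
rewrite mulr0 addr0 subr0 ger0_norm//; lra.
Qed.

(** The two entries of the minimum in [c] match two regimes. For [s <= t] the kernel is at least
    [s * (1 - q)] with [q <= b / (beta + eta)]; for [s > t] it is at least
    [beta * q >= a * beta / (beta + eta)], and [s <= 1]. The denominators in [c] absorb the constant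
    of [Phi]. *)
Lemma kern_ge t s : a <= t <= b -> 0 <= s <= 1 -> c * Ph s <= k t s.
Proof.
have B0 := beta_gt0; have E0 := eta_gt0; have BE := be_le1; have A0 := a_gt0;
  have AB := a_lt_b; have BB := b_lt_be.
move=> /andP[ta tb] /andP[s0 s1].
have t0 : 0 <= t by rewrite (le_trans _ ta)// ltW.
rewrite kern_cases//; set q := t / _.
set u := (beta + eta)^-1.
have u_gt0 : 0 < u by rewrite invr_gt0.
have ub : u * (beta + eta) = 1 by rewrite mulVf// gt_eqF.
have qE : q = t * u by [].
have qb : q * (beta + eta) = t by rewrite qE -mulrA ub mulr1.
have q0 : 0 <= q by rewrite divr_ge0// ltW.
have cPh : c * Ph s <= s * (a * beta * u) /\ c * Ph s <= s * ((beta + eta - b) * u).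
  rewrite /cconst /Phi; case: ifPn => [h|].
    by split; rewrite mulrC ler_wpM2l// ge_min lexx ?orbT.
  rewrite -ltNge => h; have d0 : 0 < 1 - (beta + eta) by lra.
  have dE : 1 - (beta + eta) != 0 by rewrite gt_eqF.
  rewrite mulrA mulrC; split; rewrite ler_wpM2l// -/u mulrA ler_pM2r//.
    apply: (@le_trans _ _ (a * beta / (1 - (beta + eta)) * (1 - (beta + eta)))).
      by rewrite ler_pM2r// ge_min lexx.
    by rewrite divfK.
  apply: (@le_trans _ _ ((beta + eta - b) / (1 - (beta + eta)) * (1 - (beta + eta)))).
    by rewrite ler_pM2r// ge_min lexx orbT.
  by rewrite divfK.
have [c1 c2] := cPh.
have aq : a * u <= q by rewrite qE ler_pM2r.
have qbu : q <= b * u by rewrite qE ler_pM2r.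
have sq : s * q <= s * (b * u) by rewrite ler_wpM2l.
have c2' : c * Ph s <= s - s * (b * u).
  by apply: (le_trans c2); rewrite mulrBl [(beta + eta) * u]mulrC ub mulrBr mulr1.
have abu0 : 0 <= a * beta * u by rewrite !mulr_ge0// ltW.
have c1' : c * Ph s <= a * beta * u.
  by apply: (le_trans c1); rewrite ler_piMl.
have abq : a * beta * u <= beta * q.
  by rewrite mulrAC mulrC ler_pM2l.
have [se|se] := leP s eta.
  rewrite max_l ?subr_ge0//; have [st|st] := leP s t.
    rewrite max_l ?subr_ge0//.
    have -> : beta * q + q * (eta - s) - (t - s) = s * (1 - q) by rewrite -qb; ring.
    by lra.
  rewrite max_r; last by rewrite subr_le0 ltW.
  have : 0 <= q * (eta - s) by rewrite mulr_ge0// subr_ge0.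
  by lra.
rewrite max_r; last by rewrite subr_le0 ltW.
have [st|st] := leP s t.
  rewrite max_l ?subr_ge0//.
  have -> : beta * q + q * 0 - (t - s) = s - eta * q by rewrite -qb; ring.
  have h1 : 0 <= (s - eta) * q by rewrite mulr_ge0// subr_ge0 ltW.
  by lra.
rewrite max_r; last by rewrite subr_le0 ltW.
by rewrite mulr0 addr0 subr0; lra.
Qed.

Lemma cconst_gt0 : 0 < c.
Proof.
have B0 := beta_gt0; have E0 := eta_gt0; have BE := be_le1; have A0 := a_gt0;
  have AB := a_lt_b; have BB := b_lt_be.
have h : 0 < beta + eta - b by lra.
rewrite /cconst; case: ifPn => [_|]; first by rewrite lt_min !divr_gt0// mulr_gt0.
by rewrite -ltNge => h2; rewrite lt_min !divr_gt0// ?mulr_gt0//; lra.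
Qed.

Lemma cconst_le_a : c <= a.
Proof.
have B0 := beta_gt0; have E0 := eta_gt0; have BE := be_le1; have A0 := a_gt0;
  have AB := a_lt_b; have BB := b_lt_be.
rewrite /cconst; case: ifPn => [_|].
  by rewrite ge_min ler_pdivrMr// ler_pM2l//; apply/orP; left; lra.
rewrite -ltNge => h2; rewrite ge_min ler_pdivrMr; last by lra.
by rewrite ler_pM2l//; apply/orP; left; lra.
Qed.

Lemma cconst_le1 : c <= 1.
Proof.
have B0 := beta_gt0; have E0 := eta_gt0; have BE := be_le1; have A0 := a_gt0;
  have AB := a_lt_b; have BB := b_lt_be.
by have := cconst_le_a; lra.
Qed.

Lemma gamma_ge t t' : a <= t -> 0 <= t' <= 1 -> c * ga t' <= ga t.
Proof.
move=> ta /andP[t0 t1]; have t'0 : 0 <= t by rewrite (le_trans _ ta)// ltW.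
rewrite !gammaE// mulrA ler_pM2r ?invr_gt0//; apply: (le_trans _ ta).
apply: le_trans cconst_le_a.
by rewrite ler_piMr// ltW// cconst_gt0.
Qed.

Lemma kern_continuous_l s : {within [set` `[0, 1]], continuous (k ^~ s)}.
Proof.
have : {within [set` `[0, 1]], continuous (fun t =>
  beta * t / (beta + eta) + t / (beta + eta) * Num.max (eta - s) 0
  - (t - s + `|t - s|) / 2)}.
  apply: continuous_subspaceT => t; apply: cvgB.
    apply: cvgD.
      by apply: cvgMl; apply: cvgMr; exact: cvg_id.
    by apply: cvgMl; apply: cvgMl; exact: cvg_id.
  apply: cvgMl; apply: cvgD; first by apply: cvgB; [exact: cvg_id|exact: cvg_cst].
  by apply: cvg_norm; apply: cvgB; [exact: cvg_id|exact: cvg_cst].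
apply: subspace_eq_continuous => t; rewrite inE/= in_itv/= => /andP[t0 _].
by rewrite /from_subspace/= kernE heaviside_ge0//
  mulr1 [Num.max (t - s) 0]maxr_absE subr0 addr0.
Qed.

Lemma kern_continuous_r t : continuous (k t).
Proof.
have -> : k t = fun s =>
  (beta * t / (beta + eta) + t / (beta + eta) * ((eta - s + `|eta - s|) / 2)
  - ((t - s) + `|t - s|) / 2) * heaviside t.
  by apply/funext => s; rewrite kernE !maxr_absE !subr0 !addr0.
move=> s; apply: cvgMl; apply: cvgB.
  apply: cvgD; first exact: cvg_cst.
  apply: cvgMr; apply: cvgMl; apply: cvgD; first by apply: cvgB;
    [exact: cvg_cst|exact: cvg_id].
  by apply: cvg_norm; apply: cvgB; [exact: cvg_cst|exact: cvg_id].
apply: cvgMl; apply: cvgD; first by apply: cvgB; [exact: cvg_cst|exact: cvg_id].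
by apply: cvg_norm; apply: cvgB; [exact: cvg_cst|exact: cvg_id].
Qed.

Lemma gamma_continuous : {within [set` `[0, 1]], continuous ga}.
Proof.
have : {within [set` `[0, 1]], continuous (fun t : R => t / (beta + eta))}.
  by apply: continuous_subspaceT => t; apply: cvgMl; exact: cvg_id.
apply: subspace_eq_continuous => t; rewrite inE/= in_itv/= => /andP[t0 _].
by rewrite /from_subspace/= gammaE.
Qed.

End kernel.

(** * Lebesgue measurability of continuous functions *)

Section lebesgue_measurability.
Variable R : realType.
Local Notation TT := (caratheodory_type (mu_ext (wlength (idfun : R -> R)))).

Lemma borel_lebesgue_set (D : set R) :
  @measurable _ (measurableTypeR R) D -> @measurable _ TT D.
Proof. by move=> mD; exact: sub_caratheodory. Qed.

Lemma measurable_segment (p q : R) : @measurable _ TT [set` `[p, q]].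
Proof. by apply: borel_lebesgue_set; exact: measurable_itv. Qed.

Lemma continuous_lebesgue_measurable (D : set R) (f : R -> R) :
  @measurable _ TT D -> continuous f -> lebesgue_measurable D f.
Proof.
move=> mD cf _ B mB; apply: measurableI => //.
apply: borel_lebesgue_set; rewrite -[f @^-1` B]setTI.
by apply: continuous_measurable_fun.
Qed.

#[global] Instance ae_lebesgue_filter : Filter (almost_everywhere (@completed_lebesgue_measure R)).
Proof. exact: (ae_filter_ringOfSetsType (completed_lebesgue_measure : {measure set TT -> \bar R})). Qed.

End lebesgue_measurability.

(** * The kernel with the boundary functional eliminated *)

Section green.
Variables (R : realType) (beta eta a b : R) (g A : R -> R).
Hypotheses (beta_gt0 : 0 < beta) (eta_gt0 : 0 < eta) (be_le1 : beta + eta <= 1).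
Hypotheses (a_gt0 : 0 < a) (a_lt_b : a < b) (b_lt_be : b < beta + eta).
Hypotheses (Hg : g_hyp beta eta g) (HA : A_hyp beta eta A).
Local Notation TT := (caratheodory_type (mu_ext (wlength (idfun : R -> R)))).
Local Notation k := (kern beta eta).
Local Notation Ph := (Phi beta eta).
Local Notation ga := (gamma beta eta).
Local Notation c := (cconst beta eta a b).
Local Notation D01 := [set` `[0 : R, 1]].

Let bvA : bounded_variation 0 1 A. Proof. by case: HA. Qed.
Let V := cvar A 1 - cvar A 0.

Lemma KA_cvg s : (fun n => usum A (k ^~ s) n.+1) @ \oo --> KA beta eta A s.
Proof. by apply: usum_cvg => //; exact: kern_continuous_l. Qed.

Lemma usum_kern_le n s : 0 <= s <= 1 -> `|usum A (k ^~ s) n.+1| <= Ph s * V.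
Proof.
move=> s01; apply: usum_le => // t; rewrite in_itv/= => t01.
exact: kern_le.
Qed.

Lemma KA_le s : 0 <= s <= 1 -> `|KA beta eta A s| <= Ph s * V.
Proof.
move=> s01.
have h : (fun n => `|usum A (k ^~ s) n.+1|) @ \oo --> `|KA beta eta A s|.
  by apply: cvg_norm; exact: KA_cvg.
rewrite -(cvg_lim (@Rhausdorff R) h); apply: limr_le; first by apply/cvg_ex; eexists;
  exact: h.
by apply: nearW => n; exact: usum_kern_le.
Qed.

Lemma kern_measurable t : lebesgue_measurable D01 (k t).
Proof.
apply: continuous_lebesgue_measurable; first exact: measurable_segment.
exact: kern_continuous_r.
Qed.

Lemma usum_kern_measurable n : lebesgue_measurable D01 (fun s => usum A (k ^~ s) n).
Proof.
rewrite /usum /lebesgue_measurable; apply: measurable_sum => i.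
by apply: measurable_funM; [exact: kern_measurable|exact: measurable_cst].
Qed.

Lemma KA_measurable : lebesgue_measurable D01 (KA beta eta A).
Proof.
apply: measurable_fun_cvg => [n|s _]; last exact: KA_cvg.
exact: usum_kern_measurable.
Qed.

(* Applying [alpha A] to the integral equation and solving for [alpha A u] turns it into an
   equation with this kernel and without the boundary functional. *)
Definition green (t s : R) : R :=
  k t s + ga t / (1 - alpha A ga) * KA beta eta A s.

Let al := alpha A ga.
Let al_lt1 : 0 < 1 - al. Proof. by case: HA => _ _ /andP[_]; rewrite subr_gt0. Qed.

(** [(beta + eta)^-1] bounds [gamma] on [[0, 1]], and [V * Phi] bounds [KA]. *)
Definition green_bound : R := 1 + (beta + eta)^-1 / (1 - al) * V.

Let be_gt0 : 0 < beta + eta. Proof. exact: addr_gt0. Qed.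

Lemma gamma_itv t : 0 <= t <= 1 -> 0 <= ga t <= (beta + eta)^-1.
Proof.
move=> /andP[t0 t1]; rewrite gammaE// divr_ge0 ?(ltW be_gt0)//=.
by rewrite ler_piMl// invr_ge0 ltW.
Qed.

Lemma green_le t s : 0 <= t <= 1 -> 0 <= s <= 1 -> `|green t s| <= green_bound * Ph s.
Proof.
move=> t01 s01; rewrite /green (le_trans (ler_normD _ _))// mulrDl mul1r lerD ?kern_le//.
have /andP[g0 g1] := gamma_itv t01.
rewrite normrM ger0_norm; last by rewrite divr_ge0// ltW.
rewrite -[leRHS]mulrA; apply: ler_pM => //; first by rewrite divr_ge0// ltW.
  by rewrite ler_wpM2r// invr_ge0 ltW.
by rewrite mulrC; exact: KA_le.
Qed.

Lemma green_measurable t : lebesgue_measurable D01 (green t).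
Proof.
rewrite /lebesgue_measurable; apply: measurable_funD; first exact: kern_measurable.
by apply: measurable_funM; [exact: measurable_cst|exact: KA_measurable].
Qed.

Lemma KA_ae_ge0 : {ae leb, forall s : R, D01 s -> 0 <= KA beta eta A s}.
Proof. by case: HA. Qed.

Lemma g_ae_ge0 : {ae leb, forall s : R, D01 s -> 0 <= g s}.
Proof. by case: Hg. Qed.

Lemma green_ge t t' s : a <= t <= b -> 0 <= t' <= 1 -> 0 <= s <= 1 ->
  0 <= KA beta eta A s -> c * `|green t' s| <= green t s.
Proof.
move=> tab t'01 s01 KA0; have c0 :=
  ltW (cconst_gt0 beta_gt0 eta_gt0 be_le1 a_gt0 a_lt_b b_lt_be).
have /andP[ta _] := tab.
apply: (@le_trans _ _ (c * (Ph s + ga t' / (1 - al) * KA beta eta A s))).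
  rewrite ler_wpM2l// (le_trans (ler_normD _ _))// lerD ?kern_le//.
  rewrite ger0_norm// mulr_ge0// divr_ge0 ?(ltW al_lt1)//.
  by have /andP[] := gamma_itv t'01.
rewrite mulrDr; apply: lerD; first exact: kern_ge.
rewrite mulrA; apply: ler_wpM2r => //.
rewrite [leLHS]mulrA; apply: ler_wpM2r; first by rewrite invr_ge0 ltW.
exact: gamma_ge.
Qed.

Lemma green_cvg (t_ : nat -> R) (t s : R) : (forall n, 0 <= t_ n <= 1) -> 0 <= t <= 1 ->
  t_ @ \oo --> t -> (fun n => green (t_ n) s) @ \oo --> green t s.
Proof.
move=> t_01 t01 tt.
have wc (f : R -> R) : {within D01, continuous f} -> (fun n => f (t_ n)) @ \oo --> f t.
  move=> /within_continuousP /(_ t); rewrite /= in_itv/= => /(_ t01) fc.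
  apply/cvgrPdist_lt => e e0; have [d d0 dP] := fc e e0.
  near=> n; apply: dP; first by rewrite /= in_itv/=.
  by near: n; have /cvgrPdist_lt := tt; exact.
apply: cvgD; first by apply: (wc (k ^~ s)); exact: kern_continuous_l.
by apply: cvgMl; apply: cvgMl; apply: (wc ga); exact: gamma_continuous.
Unshelve. all: by end_near. Qed.

Lemma green0 s : 0 <= s -> green 0 s = 0.
Proof.
move=> s0; rewrite /green gammaE// mul0r !mul0r addr0 kernE sub0r mulr0 !mul0r.
by rewrite max_r ?oppr_le0// addr0 subr0 mul0r.
Qed.

Definition wgt (s : R) : R := g s * Ph s.

Lemma wgt_integrable : leb.-integrable D01 (EFin \o wgt).
Proof. by case: Hg. Qed.

Lemma g_measurable : lebesgue_measurable D01 g.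
Proof. by case: Hg. Qed.

Lemma green_g_integrable t : 0 <= t <= 1 ->
  leb.-integrable D01 (fun s => (green t s * g s)%:E).
Proof.
move=> t01; apply: (@ae_le_integrable _ TT R leb D01 (measurable_segment 0 1) (fun s =>
  green t s * g s) (fun s => green_bound * wgt s)).
- by apply: measurable_funM; [exact: green_measurable|exact: g_measurable].
- have := integrableZl (measurable_segment 0 1) green_bound wgt_integrable.
  by apply: eq_integrable => //; exact: measurable_segment.
- apply: filterS g_ae_ge0 => s gs s01; have {}gs := gs s01.
  rewrite normrM (ger0_norm gs) /wgt mulrCA mulrC [_ * Ph s]mulrC ler_wpM2l//.
  by rewrite mulrC; apply: green_le => //; move: s01; rewrite /= in_itv.
Qed.

End green.

(** * The superposition operator *)

Lemma supnorm_le (R : realType) (p q M : R) (f : R -> R) : p <= q ->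
  (forall x, x \in `[p, q] -> `|f x| <= M) -> supnorm p q f <= M.
Proof.
move=> pq fM; apply: ge_sup; first by exists `|f p|, p => //=; rewrite in_itv/= lexx.
by move=> _ [x xpq <-]; exact: fM.
Qed.

Lemma le_supnorm (R : realType) (p q x : R) (f : R -> R) : p <= q ->
  {within [set` `[p, q]], continuous f} -> x \in `[p, q] -> `|f x| <= supnorm p q f.
Proof.
move=> pq cf xpq; have cnf : {within [set` `[p, q]], continuous (fun x => `|f x|)}.
  by move=> y; apply: cvg_norm; exact: cf.
have [m mpq mP] := EVT_max pq cnf.
apply: ub_le_sup; last by exists x.
by exists `|f m| => _ [y ypq <-]; exact: mP.
Qed.

Section superposition.
Variables (R : realType) (r : R) (psi : R -> R) (F : R -> (R -> R) -> R).
Hypotheses (r_gt0 : 0 < r) (Hpsi : psi_hyp r psi) (HF : F_hyp r F).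
Local Notation TT := (caratheodory_type (mu_ext (wlength (idfun : R -> R)))).
Local Notation D01 := [set` `[0 : R, 1]].

(* [v] is the deviation of the unknown function from [psi]. *)
Definition admissible (v : R -> R) := continuous v /\ forall t, t <= 0 -> v t = 0.

Local Notation sol v := (fun t => psi t + v t).

Definition nemytskii (v : R -> R) (s : R) : R := F s (history r (sol v) s).

Definition unif_cvg (p q : R) (v_ : nat -> R -> R) (v : R -> R) :=
  forall e, 0 < e -> \forall n \near \oo, forall t, t \in `[p, q] -> `|v_ n t - v t| <= e.

Lemma sol_continuous v : admissible v -> {within [set` `[- r, 1]], continuous (sol v)}.
Proof.
move=> [cv _] x; apply: cvgD; first exact: (Hpsi.1 x).
exact: (continuous_subspaceT cv).
Qed.

Let shift_itv (s x : R) : 0 <= s <= 1 -> - r <= x <= 0 -> - r <= s + x <= 1.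
Proof. by move=> /andP[? ?] /andP[? ?]; apply/andP; split; lra. Qed.

Lemma history_Cspace v s : admissible v -> 0 <= s <= 1 ->
  Cspace (- r) 0 (history r (sol v) s).
Proof.
move=> av s01; split; last by move=> x /negbTE xr; rewrite /history xr.
apply/within_continuousP => x xr e e0.
have /within_continuousP/(_ (s + x)) := sol_continuous av.
rewrite /= in_itv/= => /(_ _ _ e0)[|d d0 dP].
  by apply: shift_itv => //; move: xr; rewrite /= in_itv.
exists d => // y yr xy; rewrite /history.
have -> : x \in `[- r, 0] by exact: xr.
have -> : y \in `[- r, 0] by exact: yr.
apply: dP; last by rewrite opprD addrACA subrr add0r.
by rewrite /= in_itv/= shift_itv//; move: yr; rewrite /= in_itv.
Qed.

Lemma F_ae_cvg : {ae leb, forall s, D01 s -> forall (f_ : nat -> R -> R) f,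
  (forall n, Cspace (- r) 0 (f_ n)) -> Cspace (- r) 0 f -> unif_cvg (- r) 0 f_ f ->
  (fun n => F s (f_ n)) @ \oo --> F s f}.
Proof.
have [_ _ Fc _] := HF; apply: filterS Fc => s Fs s01 f_ f Cf_ Cf ff.
apply/cvgrPdistC_lt => e e0; have [d d0 dP] := Fs s01 f Cf e e0.
have d20 : 0 < d / 2 by rewrite divr_gt0.
apply: filterS (ff _ d20) => n fn; apply: dP => //.
apply: (@le_lt_trans _ _ (d / 2)); last by rewrite gtr_pMr// invf_lt1// ltr1n.
by apply: supnorm_le => //; rewrite oppr_le0 ltW.
Qed.

Lemma nemytskii_ae_cvg : {ae leb, forall s, D01 s -> forall (v_ : nat -> R -> R) v,
  (forall n, admissible (v_ n)) -> admissible v -> unif_cvg 0 1 v_ v ->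
  (fun n => nemytskii (v_ n) s) @ \oo --> nemytskii v s}.
Proof.
apply: filterS F_ae_cvg => s Fs s01 v_ v av_ av vv.
have s01' : 0 <= s <= 1 by move: s01; rewrite /= in_itv.
apply: Fs => // [n||e e0]; [exact: history_Cspace|exact: history_Cspace|].
apply: filterS (vv e e0) => n vn x xr; rewrite /history xr.
rewrite opprD addrACA subrr add0r.
have [sx|sx] := leP (s + x) 0; last first.
  apply: vn; rewrite in_itv/= (ltW sx)/=; move: xr s01';
    rewrite in_itv/= => /andP[? ?] /andP[? ?]; lra.
by rewrite (av_ n).2// av.2// subrr normr0 ltW.
Qed.

Lemma nemytskii_ge0 v s : admissible v -> D01 s -> 0 <= nemytskii v s.
Proof.
move=> av s01; have [F0 _ _ _] := HF; apply: F0; first exact: s01.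
by apply: history_Cspace => //; move: s01; rewrite /= in_itv.
Qed.

(* The delayed argument is frozen on each cell of a uniform grid, where measurability
   of [F] in its first argument applies. *)
Let frozen (v : R -> R) (n : nat) (s : R) : R :=
  \sum_(i < n.+2) \1_([set` `[(i%:R / n.+1%:R)%R, (i.+1%:R / n.+1%:R)%R[]) s
     * F s (history r (sol v) (i%:R / n.+1%:R)).

Let frozenE v n s : 0 <= s <= 1 -> exists m : nat, [/\ 0 <= (m%:R / n.+1%:R : R) <= 1,
  `|m%:R / n.+1%:R - s| < n.+1%:R^-1 &
  frozen v n s = F s (history r (sol v) (m%:R / n.+1%:R))].
Proof.
move=> /andP[s0 s1]; pose m := Num.truncn (n.+1%:R * s); exists m.
have n0 : 0 < n.+1%:R :> R by [].
have /andP[m1 m2] : m%:R <= n.+1%:R * s < m.+1%:R by apply: truncn_itv; rewrite mulr_ge0.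
(* Equality occurs at [s = 1], which is why [frozen] has [n.+2] cells. *)
have mn : (m <= n.+1)%N.
  by rewrite -(ler_nat R) (le_trans m1)// ler_piMr.
have l1 : m%:R / n.+1%:R <= s by rewrite ler_pdivrMr// mulrC.
have l2 : s < m.+1%:R / n.+1%:R by rewrite ltr_pdivlMr// mulrC.
split.
- by rewrite divr_ge0//= ler_pdivrMr// mul1r ler_nat.
- rewrite distrC ger0_norm ?subr_ge0// ltrBlDl; apply: (lt_le_trans l2).
  by rewrite -natr1 mulrDl mul1r.
have mlt : (m < n.+2)%N by rewrite ltnS.
rewrite /frozen (bigD1 (Ordinal mlt))//= big1 => [|i im].
  by rewrite addr0 indicE mem_set ?mul1r//= in_itv/= l1 l2.
rewrite indicE memNset ?mul0r//= in_itv/= => /andP[i1 i2].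
move/eqP : im; apply; apply/val_inj => /=; apply/eqP; rewrite eqn_leq.
move: i1 i2; rewrite ler_pdivrMr// ltr_pdivlMr// [s * _]mulrC => i1 i2.
by rewrite -[(i <= m)%N]ltnS -[(m <= i)%N]ltnS -!(ltr_nat R) (le_lt_trans i1 m2) (le_lt_trans m1 i2).
Qed.

Lemma nemytskii_measurable v : admissible v -> lebesgue_measurable D01 (nemytskii v).
Proof.
move=> av.
apply: (@ae_cvg_measurable _ TT R leb completed_lebesgue_measure_is_complete D01 (frozen v)).
  move=> n; rewrite /frozen; apply: measurable_sum => i.
  apply: measurable_funM.
    by apply: measurable_indic; apply: borel_lebesgue_set; exact: measurable_itv.
  have [_ Fm _ _] := HF; apply: Fm; apply: history_Cspace => //.
  by rewrite divr_ge0//= ler_pdivrMr// mul1r ler_nat -ltnS.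
apply: filterS F_ae_cvg => s Fs s01.
have s01' : 0 <= s <= 1 by move: s01; rewrite /= in_itv.
have /choice[m mP] := fun n => @frozenE v n s s01'.
have -> : frozen v ^~ s = fun n => F s (history r (sol v) ((m n)%:R / n.+1%:R)).
  by apply/funext => n; case: (mP n).
apply: Fs => // [n||e e0].
- by apply: history_Cspace => //; case: (mP n).
- exact: history_Cspace.
have [d d0 dP] := segment_unif_continuous (sol_continuous av) e0.
have := near_infty_natSinv_lt (PosNum d0); apply: filterS => n /= nd x xr.
have [m1 m2 _] := mP n; rewrite /history xr ltW// dP//.
- by rewrite in_itv/= shift_itv//; move: xr; rewrite in_itv.
- by rewrite in_itv/= shift_itv//; move: xr; rewrite in_itv.
- by rewrite opprD addrACA subrr addr0 (lt_trans m2).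
Qed.

Lemma history_supnorm_le v s M : admissible v -> 0 <= s <= 1 ->
  supnorm (- r) 0 psi <= M -> (forall t, t \in `[0, 1] -> `|v t| <= M) ->
  supnorm (- r) 0 (history r (sol v) s) <= M.
Proof.
move=> av /andP[s0 s1] pM vM; have rle : - r <= 0 by rewrite oppr_le0 ltW.
have cpsi : {within [set` `[- r, 0]], continuous psi}.
  apply: (continuous_subspaceW _ Hpsi.1) => x; rewrite /= !in_itv/= => /andP[-> x0].
  by rewrite (le_trans x0).
apply: supnorm_le => // x xr; rewrite /history xr.
move: xr; rewrite in_itv/= => /andP[x0 x1].
have [sx|sx] := leP (s + x) 0.
  rewrite av.2// addr0; apply: le_trans pM; apply: le_supnorm => //.
  by rewrite in_itv/= sx andbT; lra.
have sx01 : s + x \in `[0, 1] by rewrite in_itv/= (ltW sx)/=; lra.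
by rewrite Hpsi.2// add0r vM.
Qed.

Lemma nemytskii_bounded M : exists2 B : R, 0 <= B & {ae leb, forall s, D01 s ->
  forall v, admissible v -> (forall t, t \in `[0, 1] -> `|v t| <= M) ->
    nemytskii v s <= B}.
Proof.
have [_ _ _ Fb] := HF.
pose rad := Num.max 1 (Num.max M (supnorm (- r) 0 psi)).
have rad0 : 0 < rad by rewrite lt_max ltr01.
have [vphi [_ [B vB] Fv]] := Fb rad rad0.
exists (Num.max 0 B); first by rewrite le_max lexx.
apply: filterS2 vB Fv => s sB sF s01 v av vM.
have s01' : 0 <= s <= 1 by move: s01; rewrite /= in_itv.
apply: (le_trans (sF s01 _ (history_Cspace av s01') _)).
  apply: history_supnorm_le => //; first by rewrite !le_max lexx !orbT.
  by move=> t t01; rewrite (le_trans (vM t t01))// !le_max lexx !orbT.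
by rewrite le_max (le_trans (ler_norm _) (sB s01)) orbT.
Qed.

End superposition.

(** * Piecewise linear approximation *)

Section hats.
Variables (R : realType) (n : nat).
Local Notation N := n.+1.

Definition clip (x : R) : R := Num.max 0 (Num.min x 1).

Lemma clip_itv x : 0 <= clip x <= 1.
Proof. by rewrite /clip le_max lexx/= ge_max ler01/= ge_min lexx orbT. Qed.

Lemma clip_le x y : x <= y -> clip x <= clip y.
Proof.
move=> xy; rewrite /clip ge_max le_max lexx/= le_max; apply/orP; right.
by rewrite le_min !ge_min xy lexx orbT.
Qed.

Lemma clip_lo x : x <= 0 -> clip x = 0.
Proof. by move=> x0; rewrite /clip min_l ?max_l// (le_trans x0). Qed.

Lemma clip_hi x : 1 <= x -> clip x = 1.
Proof. by move=> x1; rewrite /clip min_r ?max_r. Qed.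

Lemma clip_continuous : continuous clip.
Proof.
have -> : clip = fun x =>
  (0 + ((x + 1 - `|x - 1|) / 2) + `|0 - (x + 1 - `|x - 1|) / 2|) / 2.
  by apply/funext => x; rewrite /clip maxr_absE minr_absE.
move=> x.
have h : (fun x : R => (x + 1 - `|x - 1|) / 2) @ x --> (x + 1 - `|x - 1|) / 2.
  apply: cvgMl; apply: cvgB; first by apply: cvgD; [exact: cvg_id|exact: cvg_cst].
  by apply: cvg_norm; apply: cvgB; [exact: cvg_id|exact: cvg_cst].
apply: cvgMl; apply: cvgD; first by apply: cvgD; [exact: cvg_cst|exact: h].
by apply: cvg_norm; apply: cvgB; [exact: cvg_cst|exact: h].
Qed.

(* [hat j] is the piecewise linear function with value 1 at the grid point [(j + 1) / N]
   and 0 at the other multiples of [1 / N]; the hat of the point 0 is left out so that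
   the combinations vanish on the negative half-line. *)
Definition hat (j : 'I_N) (t : R) : R :=
  clip (N%:R * t - j%:R) - clip (N%:R * t - j.+1%:R).

Lemma hat_ge0 j t : 0 <= hat j t.
Proof. by rewrite subr_ge0 clip_le// lerD2l lerN2 ler_nat. Qed.

Lemma hat_continuous j : continuous (hat j).
Proof.
have cc (m : R) : continuous (fun t : R => clip (N%:R * t - m)).
  move=> t; apply: (@continuous_comp _ _ _ (fun t : R => N%:R * t - m) clip);
    last exact: clip_continuous.
  by apply: cvgB; [apply: cvgMr; exact: cvg_id|exact: cvg_cst].
by move=> t; apply: cvgB; exact: cc.
Qed.

Lemma hat_neg j t : t <= 0 -> hat j t = 0.
Proof.
move=> t0; have h : N%:R * t <= 0 by rewrite mulr_ge0_le0.
by rewrite /hat !clip_lo ?subrr// subr_le0 (le_trans h).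
Qed.

Lemma sum_hat t : t <= 1 -> \sum_j hat j t = clip (N%:R * t).
Proof.
move=> t1; rewrite /hat.
transitivity (- \sum_(0 <= j < N) (clip (N%:R * t - j.+1%:R) - clip (N%:R * t - j%:R))).
  by rewrite big_mkord -sumrN; apply: eq_bigr => j _; rewrite opprB.
rewrite (telescope_sumr (fun j => clip (N%:R * t - j%:R)))// subr0 opprB.
by rewrite [X in _ - X]clip_lo ?subr0// subr_le0 ler_piMr.
Qed.

Lemma hat_neq0 j t : hat j t != 0 -> `|t - j.+1%:R / N%:R| <= N%:R^-1.
Proof.
have n0 : 0 < N%:R :> R by [].
move=> h; have [l|l] := leP (N%:R * t) j%:R.
  by move: h; rewrite /hat !clip_lo ?subrr ?eqxx// subr_le0// (le_trans l)// ler_nat.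
have [u|u] := leP (j.+2%:R) (N%:R * t).
  move: h; rewrite /hat !clip_hi ?subrr ?eqxx// lerBrDl (le_trans _ u)//.
    by rewrite -[1]/(1%:R) -natrD ler_nat addn1.
  by rewrite -[1]/(1%:R) -natrD ler_nat addn1.
rewrite -(ler_pM2l n0) -{1}(gtr0_norm n0) -normrM mulrBr mulrCA divff ?gt_eqF// mulr1.
rewrite ler_norml; apply/andP; split.
  by rewrite lerBrDl -natr1 addrK ltW.
by rewrite lerBlDl natr1 ltW.
Qed.

Definition pl (x : 'I_N -> R) (t : R) : R := \sum_j x j * hat j t.

Lemma pl_admissible x : admissible (pl x).
Proof.
split => [t|t t0]; last by rewrite /pl big1// => j _; rewrite hat_neg// mulr0.
have H s : (fun u => \sum_(j <- s) x j * hat j u) @ t --> \sum_(j <- s) x j * hat j t.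
  elim: s => [|j s IH].
    by under eq_fun do rewrite big_nil; rewrite big_nil; exact: cvg_cst.
  under eq_fun do rewrite big_cons; rewrite big_cons.
  by apply: cvgD; [apply: cvgMr; exact: hat_continuous|exact: IH].
exact: H.
Qed.

Lemma hat_comb_le (y : 'I_N -> R) (E t : R) :
  (forall j, hat j t != 0 -> `|y j| <= E) ->
    `|\sum_j y j * hat j t| <= E * \sum_j hat j t.
Proof.
move=> yE; rewrite (le_trans (ler_norm_sum _ _ _))// mulr_sumr; apply: ler_sum => j _.
rewrite normrM (ger0_norm (hat_ge0 j t)); have [->|h] := eqVneq (hat j t) 0.
  by rewrite !mulr0.
by rewrite ler_wpM2r ?hat_ge0// yE.
Qed.

Lemma sum_hat_itv t : t <= 1 -> 0 <= \sum_j hat j t <= 1.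
Proof. by move=> t1; rewrite sum_hat// clip_itv. Qed.

Lemma pl_le x M t : 0 <= M -> t <= 1 -> (forall j, `|x j| <= M) -> `|pl x t| <= M.
Proof.
move=> M0 t1 xM; apply: (le_trans (hat_comb_le (E := M) _)) => //.
by have /andP[_ ?] := sum_hat_itv t1; rewrite ler_piMr.
Qed.

Lemma pl_unif_cvg (x_ : nat -> 'I_N -> R) x :
  (forall j, x_ ^~ j @ \oo --> x j) -> unif_cvg 0 1 (fun m => pl (x_ m)) (pl x).
Proof.
move=> xx e e0.
have : \forall m \near \oo, forall j, `|x_ m j - x j| <= e.
  by apply: filter_forall => j; have /cvgrPdistC_le := xx j; exact.
apply: filterS => m xm t; rewrite in_itv/= => /andP[_ t1].
rewrite /pl -sumrB (eq_bigr (fun j => (x_ m j - x j) * hat j t)); last first.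
  by move=> j _; rewrite mulrBl.
exact: (@pl_le (fun j => x_ m j - x j) e t (ltW e0) t1 xm).
Qed.

End hats.

Section nodes.
Variables (R : realType) (a b : R) (n : nat).
Hypotheses (a_gt0 : 0 < a) (a_lt_b : a < b) (b_le1 : b <= 1) (na : n.+1%:R^-1 <= a).
Local Notation N := n.+1.

Definition near_ab : pred 'I_N := fun j =>
  (a - N%:R^-1 <= j.+1%:R / N%:R) && (j.+1%:R / N%:R <= b + N%:R^-1).

(* Grid points within one step of [a, b] are moved into it, so that on [a, b] the hats
   only see nodes of [a, b]. *)
Definition node (j : 'I_N) : R :=
  if near_ab j then Num.max a (Num.min b (j.+1%:R / N%:R)) else j.+1%:R / N%:R.

Let N_gt0 : 0 < N%:R^-1 :> R. Proof. by rewrite invr_gt0. Qed.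

Lemma node_ab j : near_ab j -> a <= node j <= b.
Proof.
by move=> Ij; rewrite /node Ij le_max lexx/= ge_max (ltW a_lt_b) ge_min lexx.
Qed.

Lemma node_dist j : `|node j - j.+1%:R / N%:R| <= N%:R^-1.
Proof.
have N0 := N_gt0; have ab := a_lt_b.
rewrite /node; case: ifPn => [/andP[]|_]; last by rewrite subrr normr0 ltW.
move: N0; move: (j.+1%:R / N%:R : R) => p; move: (N%:R^-1 : R) => h N0 p1 p2;
  have [pb|pb] := leP b p.
  rewrite max_r ?(ltW a_lt_b)// ler_norml; apply/andP; split; lra.
have [pa|pa] := leP a p; first by rewrite subrr normr0 ltW.
rewrite ler_norml; apply/andP; split; lra.
Qed.

Lemma node_itv j : 0 <= node j <= 1.
Proof.
have [Ij|Ij] := boolP (near_ab j).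
  have /andP[h1 h2] := node_ab Ij.
  by rewrite (le_trans (ltW a_gt0) h1)/= (le_trans h2).
by rewrite /node (negbTE Ij) divr_ge0//= ler_pdivrMr// mul1r ler_nat.
Qed.

Lemma hat_near_ab j t : a <= t <= b -> hat j t != 0 -> near_ab j.
Proof.
move=> /andP[ta tb] /hat_neq0; rewrite /near_ab.
move: (j.+1%:R / N%:R : R) => p; move: (N%:R^-1 : R) => h.
by rewrite ler_norml => /andP[h1 h2]; apply/andP; split; lra.
Qed.

Lemma hat_node_dist j t : hat j t != 0 -> `|t - node j| <= 2 / N%:R.
Proof.
move=> h; apply: (le_trans (ler_distD (j.+1%:R / N%:R) _ _)).
have -> : 2 / N%:R = N%:R^-1 + N%:R^-1 :> R by ring.
by apply: lerD; [exact: hat_neq0|rewrite distrC; exact: node_dist].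
Qed.

Lemma sum_hat_eq1 (t : R) : N%:R^-1 <= t -> t <= 1 -> \sum_(j < N) hat j t = 1.
Proof.
by move=> t0 t1; rewrite sum_hat// clip_hi// -ler_pdivrMl// mulr1.
Qed.

(** On [[a, b]] the value of [pl x] is a convex combination of coordinates in [near_ab]: [na] keeps
    [t] out of the first cell, where the hats sum to less than 1. *)
Lemma pl_itv (x : 'I_N -> R) (lo hi t : R) : a <= t <= b ->
  (forall j, near_ab j -> lo <= x j <= hi) -> lo <= pl x t <= hi.
Proof.
move=> tab xl; have /andP[ta tb] := tab.
have s1 : \sum_(j < N) hat j t = 1.
  by rewrite sum_hat_eq1// ?(le_trans na)// (le_trans tb).
have cmp (y z : 'I_N -> R) : (forall j, near_ab j -> y j <= z j) ->
    \sum_j y j * hat j t <= \sum_j z j * hat j t.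
  move=> yz; apply: ler_sum => j _; have [->|h] := eqVneq (hat j t) 0.
    by rewrite !mulr0.
  by rewrite ler_wpM2r ?hat_ge0// yz// (hat_near_ab tab).
rewrite -[lo]mulr1 -[hi]mulr1 -s1 !mulr_sumr.
by apply/andP; split; apply: cmp => j /xl/andP[].
Qed.

End nodes.

(** * The integral operator and its fixed points *)

Section operator.
Variables (R : realType) (r beta eta a b : R).
Variables (psi g A : R -> R) (F : R -> (R -> R) -> R).
Hypotheses (r_gt0 : 0 < r) (beta_gt0 : 0 < beta) (eta_gt0 : 0 < eta) (be_le1 : beta + eta <= 1).
Hypotheses (a_gt0 : 0 < a) (a_lt_b : a < b) (b_lt_be : b < beta + eta).
Hypotheses (Hpsi : psi_hyp r psi) (Hg : g_hyp beta eta g) (HF : F_hyp r F) (HA : A_hyp beta eta A).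
Local Notation TT := (caratheodory_type (mu_ext (wlength (idfun : R -> R)))).
Local Notation k := (kern beta eta).
Local Notation Ph := (Phi beta eta).
Local Notation ga := (gamma beta eta).
Local Notation c := (cconst beta eta a b).
Local Notation D01 := [set` `[0 : R, 1]].
Local Notation W := (nemytskii r psi F).
Local Notation gr := (green beta eta A).
Local Notation GB := (green_bound beta eta A).
Local Notation adm := (@admissible R).
Local Notation mD01 := (measurable_segment (0 : R) 1).

Definition Sop (v : R -> R) (t : R) : R := \int[leb]_(s in D01) (gr t s * g s * W v s).

Let D01E s : D01 s -> 0 <= s <= 1. Proof. by rewrite /= in_itv. Qed.

Let ab01 t : a <= t <= b -> 0 <= t <= 1.
Proof.
move=> /andP[ta tb]; rewrite (le_trans (ltW a_gt0) ta)/=.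
exact: le_trans tb (le_trans (ltW b_lt_be) be_le1).
Qed.

Lemma Sop_integrand_measurable v t : adm v ->
  lebesgue_measurable D01 (fun s => gr t s * g s * W v s).
Proof.
move=> av; apply: measurable_funM; last exact: nemytskii_measurable.
by apply: measurable_funM; [exact: green_measurable|exact: g_measurable Hg].
Qed.

(** One null set and one majorant serve all [v] bounded by [M] and all [t]. *)
Lemma Sop_dominated M : exists2 B : R, 0 <= B &
  {ae leb, forall s, D01 s -> 0 <= g s /\
    forall v, adm v -> (forall t, t \in `[0, 1] -> `|v t| <= M) ->
    W v s <= B /\ forall t, 0 <= t <= 1 ->
      `|gr t s * g s * W v s| <= GB * B * wgt beta eta g s}.
Proof.
have [B B0 WB] := nemytskii_bounded r_gt0 Hpsi HF M; exists B => //.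
apply: filterS2 WB (g_ae_ge0 Hg) => s WBs gs s01; have {}gs := gs s01.
split => // v av vM; have WB := WBs s01 v av vM; split => // t t01.
have W0 := nemytskii_ge0 Hpsi HF av s01.
rewrite !normrM (ger0_norm gs) (ger0_norm W0).
apply: (@le_trans _ _ (GB * Ph s * g s * B)); last by rewrite /wgt le_eqVlt; apply/orP;
  left; apply/eqP; ring.
by apply: ler_pM => //; [rewrite mulr_ge0|apply: ler_wpM2r => //;
  apply: green_le => //; exact: D01E].
Qed.

Let scale_wgt_integrable (C : R) : leb.-integrable D01 (EFin \o (fun s =>
  C * wgt beta eta g s)).
Proof.
have := integrableZl mD01 C (wgt_integrable Hg).
by apply: eq_integrable => //; exact: mD01.
Qed.

Lemma Sop_cvg (M : R) (v_ : nat -> R -> R) (v : R -> R) (t : R) :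
  (forall n, adm (v_ n)) -> adm v ->
  (forall n s, s \in `[0, 1] -> `|v_ n s| <= M) -> unif_cvg 0 1 v_ v ->
  0 <= t <= 1 -> (fun n => Sop (v_ n) t) @ \oo --> Sop v t.
Proof.
move=> av_ av vM vv t01; have [B B0 HB] := Sop_dominated M.
apply: (Rintegral_dominated_cvg completed_lebesgue_measure_is_complete mD01 _ _
  (scale_wgt_integrable (GB * B)) _).2.
- by move=> n; exact: Sop_integrand_measurable.
- apply: filterS (nemytskii_ae_cvg r_gt0 Hpsi HF) => s Ws s01.
  by apply: cvgMr; exact: Ws.
- by apply: filterS HB => s Bs s01 n; apply: ((Bs s01).2 _ (av_ n) (vM n)).2.
Qed.

Lemma Sop_integrable v t : adm v -> 0 <= t <= 1 ->
  leb.-integrable D01 (EFin \o (fun s => gr t s * g s * W v s)).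
Proof.
move=> av t01; have [m m01 mP] : exists2 m, m \in `[0, 1] & forall t, t \in `[0, 1] ->
  `|v t| <= `|v m|.
  apply: (@EVT_max R (fun t => `|v t|)) => //.
  by apply: continuous_subspaceT => x; apply: cvg_norm; exact: av.1.
have [B B0 HB] := Sop_dominated `|v m|.
apply: (ae_le_integrable mD01 _ (scale_wgt_integrable (GB * B))).
  exact: Sop_integrand_measurable.
by apply: filterS HB => s Bs s01; apply: ((Bs s01).2 v av mP).2.
Qed.

Lemma Sop_bounded (M : R) : exists M' : R, forall v t, adm v ->
  (forall s, s \in `[0, 1] -> `|v s| <= M) -> 0 <= t <= 1 -> `|Sop v t| <= M'.
Proof.
have [B B0 HB] := Sop_dominated M.
exists (\int[leb]_(s in D01) (GB * B * wgt beta eta g s)) => v t av vM t01.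
apply: (ae_norm_Rintegral_le mD01 _ (scale_wgt_integrable (GB * B))).
  exact: Sop_integrand_measurable.
by apply: filterS HB => s Bs s01; apply: ((Bs s01).2 v av vM).2.
Qed.

(** The nonlinearity is at most [B] for every such [v], so the difference is controlled by the
    integral of [B * g] times the oscillation of the kernel, which no longer involves [v]. Arguing
    by contradiction yields a sequence of times, as dominated convergence requires. *)
Lemma Sop_equicontinuous (M t e : R) : 0 <= t <= 1 -> 0 < e ->
  exists2 d : R, 0 < d & forall t', 0 <= t' <= 1 -> `|t - t'| < d ->
    forall v, adm v -> (forall s, s \in `[0, 1] -> `|v s| <= M) ->
      `|Sop v t - Sop v t'| <= e.
Proof.
move=> t01 e0; apply: contrapT => H.
have {H} /choice[z zP] : forall n : nat, exists z : R * (R -> R),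
    [/\ 0 <= z.1 <= 1, `|t - z.1| < n.+1%:R^-1, adm z.2,
     (forall s, s \in `[0, 1] -> `|z.2 s| <= M) & e < `|Sop z.2 t - Sop z.2 z.1|].
  move=> n; apply: contrapT => Hn; apply: H; exists n.+1%:R^-1; first by rewrite invr_gt0.
  move=> t' t'01 tt' v av vM; rewrite leNgt; apply/negP => ev; apply: Hn.
  by exists (t', v).
have [B B0 HB] := Sop_dominated M.
pose f_ n s := (gr t s - gr (z n).1 s) * (g s * B).
have mf n : lebesgue_measurable D01 (f_ n).
  apply: measurable_funM.
    by apply: measurable_funB; exact: green_measurable.
  by apply: measurable_funM; [exact: g_measurable Hg|exact: measurable_cst].
have mfn n : lebesgue_measurable D01 (fun s => `|f_ n s|).
  by apply: measurableT_comp; [exact: normr_measurable|exact: mf].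
have z1t : (fun n => (z n).1) @ \oo --> t.
  apply: (@cvg_dist_natSinv _ _ _ 1) => n; rewrite mul1r distrC ltW//.
  by case: (zP n).
have z01 n : 0 <= (z n).1 <= 1 by case: (zP n).
have fdom : {ae leb, forall s, D01 s ->
  forall n, `|f_ n s| <= 2 * GB * B * wgt beta eta g s}.
  apply: filterS (g_ae_ge0 Hg) => s gs s01 n; have {}gs := gs s01.
  rewrite /f_ normrM (ger0_norm (mulr_ge0 gs B0)).
  apply: (@le_trans _ _ ((GB * Ph s + GB * Ph s) * (g s * B))).
    rewrite ler_wpM2r ?mulr_ge0// (le_trans (ler_normB _ _))// lerD//.
      by apply: green_le => //; exact: D01E.
    by apply: green_le => //; exact: D01E.
  by rewrite /wgt le_eqVlt; apply/orP; left; apply/eqP; ring.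
have anorm n : leb.-integrable D01 (EFin \o (fun s => `|f_ n s|)).
  apply: (ae_le_integrable mD01 _ (scale_wgt_integrable (2 * GB * B))).
    exact: mfn.
  by apply: filterS fdom => s fs s01; rewrite normr_id fs.
have [_ fc] : leb.-integrable D01 (EFin \o (fun _ : R => 0)) /\
    (fun n => \int[leb]_(s in D01) `|f_ n s|) @ \oo --> \int[leb]_(s in D01) (0 : R).
  apply: (Rintegral_dominated_cvg completed_lebesgue_measure_is_complete mD01 _ _
    (scale_wgt_integrable (2 * GB * B)) _).
  - exact: mfn.
  - apply: aeW => s s01; rewrite -(normr0 R); apply: cvg_norm.
    rewrite -(mul0r (g s * B)); apply: cvgMl; rewrite -(subrr (gr t s)).
    by apply: cvgB; [exact: cvg_cst|exact: green_cvg].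
  - by apply: filterS fdom => s fs s01 n; rewrite normr_id fs.
have int0 : \int[leb]_(s in D01) (0 : R) = 0 by rewrite /Rintegral integral0.
rewrite int0 in fc.
have /(@filter_ex _ (\oo : set_system nat))[n /=] : \forall n \near \oo,
  `|\int[leb]_(s in D01) `|f_ n s| | < e.
  exact: cvgr0_norm_lt.
have [_ _ av vM nlt] := zP n; rewrite ltNge => /negP; apply.
have i1 := Sop_integrable av t01; have i2 := Sop_integrable av (z01 n).
apply: (le_trans (ltW nlt)); apply: le_trans (ler_norm _).
rewrite /Sop -(RintegralB mD01 i1 i2).
apply: (ae_norm_Rintegral_le mD01 _ (anorm n)).
- by apply: measurable_funB; exact: Sop_integrand_measurable.
- apply: filterS HB => s Bs s01; have [gs Bs'] := Bs s01.
  have [WB _] := Bs' _ av vM.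
  have W0 := nemytskii_ge0 Hpsi HF av s01.
  rewrite -!mulrA -mulrBl /f_ !normrM ler_wpM2l// !ger0_norm ?mulr_ge0//.
  by rewrite ler_wpM2l.
Qed.

Lemma Sop_cone v t t' : adm v -> a <= t <= b -> 0 <= t' <= 1 ->
  c * `|Sop v t'| <= Sop v t.
Proof.
move=> av tab t'01; have c0 := cconst_gt0 beta_gt0 eta_gt0 be_le1 a_gt0 a_lt_b b_lt_be.
have t01 := ab01 tab.
have i1 := Sop_integrable av t01; have i2 := Sop_integrable av t'01.
have i2' := integrable_abse i2.
rewrite -ler_pdivlMl//; apply: (le_trans (le_normr_Rintegral mD01 i2)).
rewrite ler_pdivlMl// -RintegralZl//; last exact: mD01.
apply: ae_le_Rintegral => //; first exact: mD01.
- have := integrableZl mD01 c i2'.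
  by apply: eq_integrable => //; exact: mD01.
- apply: filterS2 (KA_ae_ge0 HA) (g_ae_ge0 Hg) => s Ks gs s01.
  have W0 := nemytskii_ge0 Hpsi HF av s01.
  rewrite !normrM (ger0_norm (gs s01)) (ger0_norm W0) !mulrA.
  apply: ler_wpM2r => //; apply: ler_wpM2r; first exact: gs.
  by apply: green_ge => //; exact: Ks.
Qed.

(** This allows fixed points to be extended continuously by zero to negative times. *)
Lemma Sop0 v : Sop v 0 = 0.
Proof.
rewrite /Sop; transitivity (\int[leb]_(s in D01) (0 : R));
  last by rewrite /Rintegral integral0.
apply: eq_Rintegral => s; rewrite inE/= in_itv/= => /andP[s0 _].
by rewrite green0// !mul0r.
Qed.

(** * The growth conditions in terms of the operator *)

Let al := alpha A ga.
Let al_lt1 : 0 < 1 - al. Proof. by case: HA => _ _ /andP[_]; rewrite subr_gt0. Qed.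

Lemma Rintegral_indic (P : set R) (f : R -> R) : @measurable _ TT P -> P `<=` D01 ->
  leb.-integrable D01 (EFin \o f) ->
  leb.-integrable D01 (EFin \o (fun s => f s * \1_P s)) /\
  \int[leb]_(s in P) f s = \int[leb]_(s in D01) (f s * \1_P s).
Proof.
move=> mP PD fi; split.
  apply: (ae_le_integrable mD01 (h := fun s => `|f s|)).
  - apply: measurable_funM; first by apply/measurable_EFinP; exact: (measurable_int leb).
    exact: measurable_indic.
  - by have := integrable_abse fi.
  - apply: aeW => s _; rewrite normrM ler_piMr// indicE.
    by case: (s \in P); rewrite ?normr1 ?normr0.
rewrite -[in LHS](setIidr PD) Rintegral_mkcondr; apply: eq_Rintegral => s _.
by rewrite /patch indicE; case: (s \in P); rewrite ?mulr1 ?mulr0.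
Qed.

Let integral_EFin (P : set R) (f : R -> R) : @measurable _ TT P ->
  leb.-integrable P (EFin \o f) ->
  (\int[leb]_(s in P) (f s)%:E = (\int[leb]_(s in P) f s)%:E)%E.
Proof.
by move=> mP fi; rewrite /Rintegral fineK//; exact: integrable_fin_num.
Qed.

Lemma kern_g_integrable t : 0 <= t <= 1 ->
  leb.-integrable D01 (EFin \o (fun s => k t s * g s)).
Proof.
move=> t01; apply: (ae_le_integrable mD01 _ (wgt_integrable Hg)).
  by apply: measurable_funM; [exact: kern_measurable|exact: g_measurable Hg].
apply: filterS (g_ae_ge0 Hg) => s gs s01; have {}gs := gs s01.
rewrite normrM (ger0_norm gs) /wgt mulrC ler_wpM2l//.
by apply: kern_le => //; exact: D01E.
Qed.

Lemma abs_kern_g_integrable t : 0 <= t <= 1 ->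
  leb.-integrable D01 (EFin \o (fun s => `|k t s| * g s)).
Proof.
move=> t01; apply: (ae_le_integrable mD01 _ (integrable_abse (kern_g_integrable t01))).
  apply: measurable_funM; last exact: g_measurable Hg.
  by apply: measurableT_comp; [exact: normr_measurable|exact: kern_measurable].
by apply: aeW => s _; rewrite (normrM `|k t s|) (normrM (k t s)) normr_id.
Qed.

Lemma KA_g_integrable : leb.-integrable D01 (EFin \o (fun s => KA beta eta A s * g s)).
Proof.
have bv : bounded_variation 0 1 A by case: HA.
apply: (ae_le_integrable mD01 _ (scale_wgt_integrable (cvar A 1 - cvar A 0))).
  apply: measurable_funM; last exact: g_measurable Hg.
  exact: KA_measurable.
apply: filterS (g_ae_ge0 Hg) => s gs s01; have {}gs := gs s01.
rewrite normrM (ger0_norm gs) /wgt mulrC mulrCA ler_wpM2l// mulrC.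
by apply: KA_le => //; exact: D01E.
Qed.

(** In the extended reals zero times infinity is zero, so finiteness of [F_up] must come from
    [inv_m] being positive. This follows from the positive integral of [Phi * g] and the lower bound
    of the kernel at [t = a]. *)
Lemma F_up_real rho : 0 < rho -> I1 r beta eta psi g A F rho ->
  (0 < \int[leb]_(s in `[a, b]) (Ph s * g s)%:E)%E ->
  exists2 m : R, 0 <= m & (forall t phi, D01 t -> Cspace (- r) 0 phi ->
     supnorm (- r) 0 phi <= rho -> F t phi <= m * rho) /\
   forall t, 0 <= t <= 1 ->
     m * (\int[leb]_(s in D01) (`|k t s| * g s) + ga t / (1 - al) *
          \int[leb]_(s in D01) (KA beta eta A s * g s)) < 1.
Proof.
move=> rho0 [_ lt1] Phig.
have mab := measurable_segment a b.
have inv_m_ge t : 0 <= t <= 1 ->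
  ((\int[leb]_(s in D01) (`|k t s| * g s) + ga t / (1 - al) *
          \int[leb]_(s in D01) (KA beta eta A s * g s))%:E <= inv_m beta eta g A)%E.
  move=> t01; apply: ereal_sup_ubound; exists t; first by rewrite /= in_itv.
  rewrite (integral_EFin mD01 (abs_kern_g_integrable t01)) (integral_EFin mD01 KA_g_integrable) EFinD EFinM.
  by rewrite ger0_norm//; have /andP[] := gamma_itv beta_gt0 eta_gt0 t01.
have a01 : 0 <= a <= 1 by apply: ab01; rewrite lexx ltW.
have abD : [set` `[a, b]] `<=` D01.
  by move=> s /=; rewrite !in_itv/=; exact: ab01.
have KA0 : 0 <= \int[leb]_(s in D01) (KA beta eta A s * g s).
  apply: (ae_Rintegral_ge0 mD01 KA_g_integrable).
  apply: filterS2 (KA_ae_ge0 HA) (g_ae_ge0 Hg) => s Ks gs s01.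
  by rewrite mulr_ge0 ?Ks ?gs.
have kpos : 0 < \int[leb]_(s in D01) (`|k a s| * g s).
  have wi := wgt_integrable Hg.
  have wiab := integrableS mD01 mab abD wi.
  have c0 := cconst_gt0 beta_gt0 eta_gt0 be_le1 a_gt0 a_lt_b b_lt_be.
  have p0 : 0 < \int[leb]_(s in `[a, b]) wgt beta eta g s.
    rewrite -lte_fin -(integral_EFin mab wiab).
    by under eq_integral do rewrite /wgt mulrC.
  apply: (lt_le_trans (mulr_gt0 c0 p0)).
  have [wi1 ->] := Rintegral_indic mab abD wi.
  rewrite -(RintegralZl _ mD01 wi1);
    apply: (ae_le_Rintegral mD01 _ (abs_kern_g_integrable a01)).
    have := integrableZl mD01 c wi1.
    by apply: eq_integrable => //; exact: mD01.
  apply: filterS (g_ae_ge0 Hg) => s gs s01; have {}gs := gs s01.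
  have kc : c * Ph s <= `|k a s|.
    apply: le_trans (ler_norm _); apply: kern_ge => //.
    by rewrite lexx ltW.
  have P0 : 0 <= Ph s by have := D01E s01 => /andP[s0 _]; exact: Phi_ge0.
  rewrite indicE; case: (s \in _); last by rewrite !mulr0 mulr_ge0.
  by rewrite mulr1 /wgt mulrCA mulrC ler_wpM2r.
have m0 : (0 < inv_m beta eta g A)%E.
  apply: lt_le_trans (inv_m_ge a a01); rewrite lte_fin ltr_wpDr//.
  rewrite mulr_ge0// divr_ge0 ?(ltW al_lt1)//.
  by have /andP[] := gamma_itv beta_gt0 eta_gt0 a01.
have Fup_ge t phi : D01 t -> Cspace (- r) 0 phi -> supnorm (- r) 0 phi <= rho ->
    ((F t phi / rho)%:E <= F_up r F rho)%E.
  by move=> t01 Cphi prho; apply: ereal_sup_ubound; exists t, phi.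
have [F0 _ _ _] := HF.
have rle : - r <= 0 by rewrite oppr_le0 ltW.
have C0 : Cspace (- r) 0 (fun _ : R => 0 : R).
  by split => //; apply: continuous_subspaceT; exact: cst_continuous.
have s0 : supnorm (- r) 0 (fun _ : R => 0 : R) <= rho.
  by apply: supnorm_le => // x _; rewrite normr0 ltW.
have z01 : D01 0 by rewrite /= in_itv/= lexx ler01.
have up0 : (0 <= F_up r F rho)%E.
  by apply: le_trans (Fup_ge 0 _ z01 C0 s0); rewrite lee_fin divr_ge0 ?F0// ltW.
move: lt1 up0 Fup_ge; case: (F_up r F rho) => [m|lt1 _ _|]; last by [].
  move=> lt1; rewrite lee_fin => m_ge0 Fup_ge; exists m => //; split.
    move=> t phi t01 Cphi prho; have := Fup_ge t phi t01 Cphi prho.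
    by rewrite lee_fin ler_pdivrMr.
  move=> t t01; rewrite -lte_fin; apply: le_lt_trans lt1.
  by rewrite EFinM; apply: lee_wpmul2l; [rewrite lee_fin|exact: inv_m_ge].
by move: lt1; rewrite gt0_mulye// ltNge leey.
Qed.

Lemma Sop_I1 rho v t : 0 < rho -> I1 r beta eta psi g A F rho ->
  (0 < \int[leb]_(s in `[a, b]) (Ph s * g s)%:E)%E ->
  adm v -> (forall t, t \in `[0, 1] -> `|v t| <= rho) -> 0 <= t <= 1 ->
  `|Sop v t| < rho.
Proof.
move=> rho0 HI1 Phig av vrho t01.
have [m m0 [Fm mlt]] := F_up_real rho0 HI1 Phig.
have := mlt t t01; set I1 := \int[leb]_(s in _) _; set I2 := \int[leb]_(s in _) _ => mlt1.
have kgi := abs_kern_g_integrable t01; pose G := ga t / (1 - al).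
have G0 : 0 <= G by rewrite divr_ge0 ?(ltW al_lt1)//; have /andP[] :=
  gamma_itv beta_gt0 eta_gt0 t01.
have gKi : leb.-integrable D01 (EFin \o (fun s => G * (KA beta eta A s * g s))).
  have := integrableZl mD01 G KA_g_integrable.
  by apply: eq_integrable => //; exact: mD01.
have sumi : leb.-integrable D01 (EFin \o (fun s =>
  `|k t s| * g s + G * (KA beta eta A s * g s))).
  exact: (integrableD mD01 kgi gKi).
have E : \int[leb]_(s in D01) (`|k t s| * g s + G * (KA beta eta A s * g s)) = I1 + G * I2.
  by rewrite (RintegralD mD01 kgi gKi) (RintegralZl _ mD01 KA_g_integrable).
apply: (@le_lt_trans _ _ (m * rho * (I1 + G * I2))); last first.
  by rewrite mulrAC -{2}[rho]mul1r ltr_pM2r.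
have si : leb.-integrable D01 (EFin \o (fun s =>
  m * rho * (`|k t s| * g s + G * (KA beta eta A s * g s)))).
  have := integrableZl mD01 (m * rho) sumi.
  by apply: eq_integrable => //; exact: mD01.
rewrite -E -(RintegralZl _ mD01 sumi).
apply: (ae_norm_Rintegral_le mD01 _ si); first exact: Sop_integrand_measurable.
apply: filterS2 (KA_ae_ge0 HA) (g_ae_ge0 Hg) => s Ks gs s01.
have {}gs := gs s01; have {}Ks := Ks s01.
have W0 := nemytskii_ge0 Hpsi HF av s01.
have Wm : W v s <= m * rho.
  apply: Fm => //; first by apply: history_Cspace => //; exact: D01E.
  by apply: history_supnorm_le => //; apply: ltW; case: HI1.
rewrite normrM mulrC; apply: ler_pM => //; first by rewrite ger0_norm.
rewrite normrM (ger0_norm gs) mulrA -mulrDl ler_wpM2r//.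
by rewrite /green (le_trans (ler_normD _ _))// lerD// ger0_norm// mulr_ge0.
Qed.

Lemma F_lo_real rho : 0 < rho -> I0 r beta eta a b g A F rho -> r < b - a ->
  exists2 m : R, 0 <= m & (forall t phi, t \in `[a, b] -> Cspace (- r) 0 phi ->
     (forall theta, theta \in `[- r, 0] -> rho <= phi theta <= rho / c) ->
       m * rho <= F t phi) /\
   forall t, a <= t <= b -> 1 < m * \int[leb]_(s in `[a + r, b]) (gr t s * g s).
Proof.
move=> rho0 lt1 rab.
have c0 := cconst_gt0 beta_gt0 eta_gt0 be_le1 a_gt0 a_lt_b b_lt_be.
have c1 := cconst_le1 beta_gt0 eta_gt0 be_le1 a_gt0 a_lt_b b_lt_be.
have mP := measurable_segment (a + r) b.
have PD : [set` `[a + r, b]] `<=` D01.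
  move=> s /=; rewrite !in_itv/= => /andP[sa sb]; apply: ab01; rewrite sb andbT.
  by apply: le_trans sa; rewrite lerDl ltW.
have inv_M_le t : a <= t <= b ->
    (inv_M r beta eta a b g A <= (\int[leb]_(s in `[(a + r)%R, b]) (gr t s * g s))%:E)%E.
  move=> tab; have t01 := ab01 tab.
  apply: ereal_inf_lbound; exists t; first by rewrite /= in_itv.
  have i1 := integrableS mD01 mP PD (kern_g_integrable t01).
  have i2 := integrableS mD01 mP PD KA_g_integrable.
  rewrite (integral_EFin mP i1) (integral_EFin mP i2) -EFinM -EFinD; congr EFin.
  rewrite -(RintegralZl _ mP i2) -(RintegralD mP i1); last first.
    by have := integrableZl mP (ga t / (1 - al)) i2; apply: eq_integrable.
  by apply: eq_Rintegral => s _; rewrite /green mulrDl mulrA.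
have Flo_le t phi : t \in `[a, b] -> Cspace (- r) 0 phi ->
    (forall theta, theta \in `[- r, 0] -> rho <= phi theta <= rho / c) ->
    (F_lo r beta eta a b F rho <= (F t phi / rho)%:E)%E.
  by move=> tab Cphi pr; apply: ereal_inf_lbound; exists t, phi.
have [F0 _ _ _] := HF.
have abD t : t \in `[a, b] -> D01 t.
  by rewrite /= !in_itv/=; exact: ab01.
have lo0 : (0 <= F_lo r beta eta a b F rho)%E.
  apply: le_ereal_inf_tmp => _ [t [phi [tab Cphi pr ->]]].
  by rewrite lee_fin divr_ge0 ?(ltW rho0)// F0//; exact: abD.
(* A constant competitor, so that the infimum [F_lo] is not infinite. *)
pose phi0 : R -> R := fun x => if x \in `[- r, 0] then rho else 0.
have C0 : Cspace (- r) 0 phi0.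
  split; last by move=> x /negbTE xr; rewrite /phi0 xr.
  apply/within_continuousP => x xr e e0; exists 1 => // y yr _.
  have -> : phi0 x = rho by rewrite /phi0; have -> : x \in `[- r, 0] by exact: xr.
  have -> : phi0 y = rho by rewrite /phi0; have -> : y \in `[- r, 0] by exact: yr.
  by rewrite subrr normr0.
have phi0r theta : theta \in `[- r, 0] -> rho <= phi0 theta <= rho / c.
  by move=> tr; rewrite /phi0 tr lexx/= ler_pdivlMr// ler_piMr// ltW.
have aab : a \in `[a, b] by rewrite in_itv/= lexx ltW.
have := Flo_le a phi0 aab C0 phi0r.
move: lt1 lo0 Flo_le; rewrite /I0; case: (F_lo r beta eta a b F rho) => [m||];
  [|by []|by []].
move=> lt1; rewrite lee_fin => m0 Flo_le _; exists m => //; split.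
  move=> t phi tab Cphi pr; have := Flo_le t phi tab Cphi pr.
  by rewrite lee_fin ler_pdivlMr.
move=> t tab; rewrite -lte_fin; apply: (lt_le_trans lt1).
by rewrite EFinM; apply: lee_wpmul2l; [rewrite lee_fin|exact: inv_M_le].
Qed.

(** For [s] in [[a + r, b]] the whole history lies over [[a, b]], where [psi] vanishes and [v] has
    values in [[rho, rho / c]]. The rest of the integrand is nonnegative almost everywhere and is
    dropped. *)
Lemma Sop_I0 rho v t : 0 < rho -> I0 r beta eta a b g A F rho -> r < b - a ->
  adm v -> (forall t, t \in `[a, b] -> rho <= v t <= rho / c) -> a <= t <= b ->
  rho < Sop v t.
Proof.
move=> rho0 HI0 rab av vrho tab.
have t01 := ab01 tab.
have c0 := cconst_gt0 beta_gt0 eta_gt0 be_le1 a_gt0 a_lt_b b_lt_be.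
have [m m0 [Fm mgt]] := F_lo_real rho0 HI0 rab.
have mP := measurable_segment (a + r) b.
have PD : [set` `[a + r, b]] `<=` D01.
  move=> s /=; rewrite !in_itv/= => /andP[sa sb]; apply: ab01; rewrite sb andbT.
  by apply: le_trans sa; rewrite lerDl ltW.
have gi : leb.-integrable D01 (EFin \o (fun s =>
  gr t s * g s)) by exact: green_g_integrable.
have := mgt t tab; have [gi1 ->] := Rintegral_indic mP PD gi => mgt1.
apply: (@lt_le_trans _ _ (m * rho * \int[leb]_(s in D01) (gr t s * g s * \1_(`[a + r,
  b]%classic) s))).
  by rewrite mulrAC -{1}[rho]mul1r ltr_pM2r.
rewrite -(RintegralZl _ mD01 gi1).
apply: (ae_le_Rintegral mD01 _ (Sop_integrable av t01)).
  have := integrableZl mD01 (m * rho) gi1.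
  by apply: eq_integrable => //; exact: mD01.
apply: filterS2 (KA_ae_ge0 HA) (g_ae_ge0 Hg) => s Ks gs s01.
have {}gs := gs s01; have {}Ks := Ks s01.
have W0 := nemytskii_ge0 Hpsi HF av s01.
(* Positivity of the kernel for [t] in [[a, b]] is the cone estimate with both times equal to
   [t]. *)
have g0 : 0 <= gr t s * g s.
  rewrite mulr_ge0//; apply: (le_trans _ (_ : c * `|gr t s| <= gr t s));
    first by rewrite mulr_ge0// ltW.
  by apply: green_ge => //; exact: Ks.
rewrite indicE; case: (boolP (s \in _)) => sP; last by rewrite !mulr0 mulr_ge0.
rewrite mulr1 mulrC; apply: ler_wpM2l => //.
move: sP; rewrite inE/= in_itv/= => /andP[s1 s2].
apply: Fm; first by rewrite in_itv/= s2 andbT (le_trans _ s1)// lerDl ltW.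
  by apply: history_Cspace => //; exact: D01E.
move=> th thr; rewrite /history thr; move: thr; rewrite in_itv/= => /andP[th1 th2].
have sab : a <= s + th <= b.
  by rewrite -[a](addrK r) lerD//= -[b]addr0 lerD.
rewrite Hpsi.2 ?add0r; first exact: vrho.
by rewrite in_itv/=; exact: ab01.
Qed.
(** It must be shown that [alpha A u = K / (1 - al)]. Uniform Stieltjes sums commute with the
    integral by linearity, and their limit gives [alpha A u = K + al / (1 - al) * K]. At negative
    times kernel and [gamma] vanish and [u = psi]. *)
Lemma Sop_solution (z : R -> R) : adm z -> (forall t, 0 <= t <= 1 -> z t = Sop z t) ->
  is_solution r beta eta psi g A F (fun t => psi t + z t).
Proof.
move=> az zS; split; first exact: sol_continuous.
have bv : bounded_variation 0 1 A by case: HA.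
pose w s := g s * W z s.
have [m m01 mP] : exists2 m, m \in `[0, 1] & forall t, t \in `[0, 1] -> `|z t| <= `|z m|.
  apply: (@EVT_max R (fun t => `|z t|)) => //.
  by apply: continuous_subspaceT => x; apply: cvg_norm; exact: az.1.
have [B B0 HB] := Sop_dominated `|z m|.
have mw : lebesgue_measurable D01 w.
  by apply: measurable_funM; [exact: g_measurable Hg|exact: nemytskii_measurable].
have w_le : {ae leb, forall s, D01 s -> forall y C : R, `|y| <= C * Ph s ->
    `|y * w s| <= C * B * wgt beta eta g s}.
  apply: filterS HB => s Bs s01 y C yC; have [gs /(_ z az mP)[WB _]] := Bs s01.
  have W0 := nemytskii_ge0 Hpsi HF az s01.
  rewrite normrM (ger0_norm (mulr_ge0 gs W0)).
  apply: (@le_trans _ _ (C * Ph s * (g s * B))).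
    by apply: ler_pM => //; [exact: mulr_ge0|exact: ler_wpM2l].
  by rewrite /wgt le_eqVlt; apply/orP; left; apply/eqP; ring.
have yw_int (y : R -> R) (C : R) : lebesgue_measurable D01 y ->
    (forall s, D01 s -> `|y s| <= C * Ph s) ->
    leb.-integrable D01 (EFin \o (fun s => y s * w s)).
  move=> my yC; apply: (ae_le_integrable mD01 _ (scale_wgt_integrable (C * B))).
    exact: measurable_funM.
  by apply: filterS w_le => s ws s01; exact: ws s01 _ _ (yC s s01).
have kw_int t : 0 <= t <= 1 -> leb.-integrable D01 (EFin \o (fun s => k t s * w s)).
  move=> t01; apply: (yw_int (k t) 1); first exact: kern_measurable.
  by move=> s s01; rewrite mul1r; apply: kern_le => //; exact: D01E.
have KAw_int : leb.-integrable D01 (EFin \o (fun s => KA beta eta A s * w s)).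
  apply: (yw_int _ (cvar A 1 - cvar A 0)); first exact: KA_measurable.
  by move=> s s01; rewrite mulrC; apply: KA_le => //; exact: D01E.
pose N t := \int[leb]_(s in D01) (k t s * w s).
pose K := \int[leb]_(s in D01) (KA beta eta A s * w s).
have SE t : 0 <= t <= 1 -> Sop z t = N t + ga t / (1 - al) * K.
  move=> t01; rewrite /N /K -(RintegralZl _ mD01 KAw_int) -(RintegralD mD01 (kw_int t t01)).
    by apply: eq_Rintegral => s _; rewrite /green /w; ring.
  have := integrableZl mD01 (ga t / (1 - al)) KAw_int.
  by apply: eq_integrable => //; exact: mD01.
have uE t : t \in `[0, 1] -> psi t + z t = N t + ga t / (1 - al) * K.
  by move=> t01; rewrite Hpsi.2// add0r -SE ?zS//; move: t01; rewrite in_itv.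
have grid01 n i : (i <= n.+1)%N -> 0 <= (i%:R / n.+1%:R : R) <= 1.
  by move=> ik; rewrite divr_ge0//= ler_pdivrMr// mul1r ler_nat.
pose u t := psi t + z t.
have usumE n : usum A u n.+1 =
    \int[leb]_(s in D01) (usum A (k ^~ s) n.+1 * w s) + usum A ga n.+1 / (1 - al) * K.
  have -> : \int[leb]_(s in D01) (usum A (k ^~ s) n.+1 * w s) = usum A N n.+1.
    rewrite [RHS]/usum big_mkord.
    transitivity (\int[leb]_(s in D01) \sum_(i < n.+1) (A (i.+1%:R / n.+1%:R) - A (i%:R / n.+1%:R)) *
        (k (i%:R / n.+1%:R) s * w s)).
      apply: eq_Rintegral => s _; rewrite /usum big_mkord mulr_suml.
      by apply: eq_bigr => i _; ring.
    have dkw (i : 'I_n.+1) : leb.-integrable D01 (EFin \o (fun s =>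
      (A (i.+1%:R / n.+1%:R) - A (i%:R / n.+1%:R)) *
        (k (i%:R / n.+1%:R) s * w s))).
      have := integrableZl mD01 (A (i.+1%:R / n.+1%:R) - A (i%:R / n.+1%:R)) (kw_int _ (grid01 n i (ltnW (ltn_ord i)))).
      by apply: eq_integrable => //; exact: mD01.
    rewrite /Rintegral; under eq_integral do rewrite -sumEFin.
    rewrite (integral_sum mD01)// -sum_fine; last first.
      by move=> i _; apply: integrable_fin_num; [exact: mD01|exact: dkw].
    apply: eq_bigr => i _; rewrite [RHS]mulrC.
    exact: (RintegralZl _ mD01 (kw_int _ (grid01 n i (ltnW (ltn_ord i))))).
  rewrite /usum !big_mkord !mulr_suml -big_split/=; apply: eq_bigr => i _.
  rewrite /u uE; last by rewrite in_itv/= grid01// ltnW.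
  by ring.
have alu : alpha A u = K / (1 - al).
  have c1 : (fun n => usum A u n.+1) @ \oo --> alpha A u.
    apply: usum_cvg => //; apply: (continuous_subspaceW _ (sol_continuous Hpsi az)).
    by move=> x; rewrite /= !in_itv/= => /andP[x0 ->];
      rewrite andbT (le_trans _ x0)// oppr_le0 ltW.
  have c2 : (fun n => usum A u n.+1) @ \oo --> K + al / (1 - al) * K.
    under eq_fun do rewrite usumE.
    apply: cvgD.
      apply: (Rintegral_dominated_cvg completed_lebesgue_measure_is_complete mD01 _ _
        (scale_wgt_integrable ((cvar A 1 - cvar A 0) * B)) _).2.
      - by move=> n; apply: measurable_funM; [exact: usum_kern_measurable|exact: mw].
      - by apply: aeW => s _; apply: cvgMl; exact: KA_cvg.
      - apply: filterS w_le => s ws s01 n; apply: ws => //.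
        by rewrite mulrC; apply: usum_kern_le => //; exact: D01E.
    apply: cvgMl; apply: cvgMl; apply: usum_cvg => //.
    exact: gamma_continuous.
  rewrite -(cvg_lim (@Rhausdorff R) c1) (cvg_lim (@Rhausdorff R) c2).
  have al0 : 1 - al != 0 by rewrite gt_eqF.
  by field.
have intE t : (fun s => (k t s * g s * F s (history r u s))%:E) = EFin \o (fun s =>
  k t s * w s).
  by apply/funext => s /=; rewrite /w /u mulrA.
move=> t; rewrite in_itv/= => /andP[rt t1].
have [t0|t0] := ltP t 0; last first.
  have t01 : 0 <= t <= 1 by rewrite t0.
  split; first by rewrite intE; exact: kw_int.
  rewrite -/u alu zS// SE// -addrA; congr (_ + (_ + _)); last first.
    by rewrite -mulrA [_^-1 * K]mulrC.
  by apply: eq_Rintegral => s _; rewrite /w mulrA.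
have k0 s : k t s = 0 by rewrite kernE heaviside_lt0// mulr0.
split.
  rewrite intE; apply: (eq_integrable mD01 (cst 0%E)); last exact: integrable0.
  by move=> s _ /=; rewrite k0 mul0r.
rewrite az.2 ?(ltW t0)// /gamma heaviside_lt0// mulr0 mul0r !addr0.
rewrite [X in _ + X](_ : _ = 0) ?addr0//.
transitivity (\int[leb]_(s in D01) (0 : R)); last by rewrite /Rintegral integral0.
by apply: eq_Rintegral => s _; rewrite k0 !mul0r.
Qed.

(** * From discrete to continuous fixed points *)

Let b_le1 : b <= 1. Proof. by rewrite (le_trans (ltW b_lt_be)). Qed.

Let node01 n (j : 'I_n.+1) : 0 <= node a b j <= 1.
Proof. exact: node_itv. Qed.

(* Averaging: [pl x t - y] is a convex combination of [x j - y] over the nodes close to [t]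
   and of [0 - y], the latter only occurring close to 0, where [Sop v 0 = 0]. *)
Lemma pl_fixed_dist n (x : 'I_n.+1 -> R) (t y E : R) :
  (forall j, Sop (pl x) (node a b j) = x j) -> 0 <= t <= 1 ->
  (forall s, 0 <= s <= 1 -> `|t - s| <= 2 / n.+1%:R -> `|Sop (pl x) s - y| <= E) ->
  `|pl x t - y| <= E.
Proof.
move=> xfix /andP[t0 t1] close; pose sg : R := \sum_(j < n.+1) hat j t.
have n0 : 0 < n.+1%:R :> R by [].
have /andP[sg0 sg1] : 0 <= sg <= 1 by exact: sum_hat_itv.
have -> : pl x t - y = \sum_j (x j - y) * hat j t + (1 - sg) * (0 - y).
  rewrite (eq_bigr (fun j => x j * hat j t - y * hat j t)); last by move=> j _;
    rewrite mulrBl.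
  by rewrite sumrB -mulr_sumr -/sg /pl; ring.
have h1 : `|\sum_j (x j - y) * hat j t| <= E * sg.
  apply: hat_comb_le => j hj; rewrite -xfix; apply: close; first exact: node01.
  exact: hat_node_dist.
have h2 : `|(1 - sg) * (0 - y)| <= (1 - sg) * E.
  rewrite normrM ger0_norm ?subr_ge0//.
  have [->|sgn] := eqVneq sg 1; first by rewrite subrr !mul0r.
  apply: ler_wpM2l; first by rewrite subr_ge0.
  rewrite -(Sop0 (pl x)); apply: close; first by rewrite lexx ler01.
  rewrite subr0 ger0_norm//.
  have : t < n.+1%:R^-1.
    rewrite ltNge; apply/negP => tn; move/eqP: sgn; apply.
    by rewrite /sg sum_hat_eq1.
  move=> /ltW/le_trans; apply.
  by rewrite ler_peMl ?invr_ge0// ler1n.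
apply: (le_trans (ler_normD _ _)); apply: (le_trans (lerD h1 h2)).
by rewrite le_eqVlt; apply/orP; left; apply/eqP; ring.
Qed.

(* Arzela-Ascoli along an ultrafilter: the functions [Sop (v n)] are equicontinuous, so their
   pointwise limit is also the uniform limit of the approximate fixed points [v n]. *)
Lemma Sop_fixpoint_of_approx (dl M : R) : 0 < dl ->
  (forall n, n.+1%:R^-1 <= a -> exists x : 'I_n.+1 -> R,
    [/\ forall j, Sop (pl x) (node a b j) = x j,
        forall j, near_ab a b j -> dl <= x j & forall j, `|x j| <= M]) ->
  exists z, [/\ adm z, forall t, 0 <= t <= 1 -> z t = Sop z t &
                forall t, a <= t <= b -> dl <= z t].
Proof.
move=> dl0 approx.
have [n0 /= n0a] :=
  @filter_ex _ (\oo : set_system nat) _ _ (near_infty_natSinv_lt (PosNum a_gt0)).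
have na n : (n + n0).+1%:R^-1 <= a.
  apply: le_trans (ltW n0a); rewrite lef_pV2 ?posrE// ler_nat ltnS; exact: leq_addl.
have /choice[v vP] : forall n, exists v : R -> R, [/\ adm v,
    forall t, t \in `[0, 1] -> `|v t| <= M, forall t, a <= t <= b -> dl <= v t &
    forall t y E, 0 <= t <= 1 ->
    (forall s, 0 <= s <= 1 -> `|t - s| <= 2 / (n + n0).+1%:R -> `|Sop v s - y| <= E) ->
    `|v t - y| <= E].
  move=> n; have [x [xfix xdl xM]] := approx _ (na n); exists (pl x); split.
  - exact: pl_admissible.
  - move=> t; rewrite in_itv/= => /andP[_ t1]; apply: pl_le => //.
    exact: le_trans (xM ord0).
  - move=> t tab.
    have /(_ _)/andP[] // := pl_itv b_le1 (na n) (x := x) (lo := dl) (hi := M) tab.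
    by move=> j Ij; rewrite xdl//= (le_trans (ler_norm _) (xM j)).
  - by move=> t y E t01 H; exact: pl_fixed_dist.
have [U [UU sU]] := ultra_above_infty.
have PU : ProperFilter U by exact: ultra_proper.
(* Clipping the time extends [Sop (v n)] to the line, constantly to the right and by
   [Sop (v n) 0 = 0] to the left, so the limit is admissible. *)
pose cl := @clip R.
have cl01 t : 0 <= cl t <= 1 := clip_itv t.
have clE t : 0 <= t <= 1 -> cl t = t.
  by move=> /andP[t0 t1]; rewrite /cl /clip min_l// max_r.
have adv n : adm (v n) by case: (vP n).
have vM n t : t \in `[0, 1] -> `|v n t| <= M by case: (vP n) => _ + _ _; apply.
have [M' SM'] := Sop_bounded M.
have /choice[z zP] : forall t, exists l : R, (fun n => Sop (v n) (cl t)) @ U --> l.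
  move=> t; have [|l _ Hl] := @ultra_cvg_bounded R U (fun n => Sop (v n) (cl t)) M' UU;
    last by exists l.
  by move=> n; apply: SM' => //; exact: vM.
have equi t e : 0 < e -> exists2 d : R, 0 < d & forall t', `|t - t'| < d ->
    (forall n, `|Sop (v n) (cl t) - Sop (v n) (cl t')| <= e) /\ `|z t - z t'| <= e.
  move=> e0; have [d d0 dP] := Sop_equicontinuous M (cl01 t) e0.
  have /cvgrPdist_lt/(_ d d0)/nbhs_ballP[d' d'0 d'P] := @clip_continuous R t.
  exists d' => // t' tt'.
  have ct n : `|Sop (v n) (cl t) - Sop (v n) (cl t')| <= e.
    by apply: dP => //; [exact: d'P|exact: vM].
  split => //.
  have lim : (fun n => `|Sop (v n) (cl t) - Sop (v n) (cl t')|) @ U --> `|z t - z t'|.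
    by apply: cvg_norm; apply: cvgB; exact: zP.
  rewrite -(cvg_lim (@Rhausdorff R) lim); apply: limr_le; first by apply/cvg_ex;
    eexists; exact: lim.
  exact: nearW.
have az : adm z.
  split => [t|t t0].
    apply/cvgrPdist_le => e e0; have [d d0 dP] := equi t e e0.
    by apply/nbhs_ballP; exists d => // t' tt'; case: (dP t' tt').
  have -> : z t = lim ((fun n =>
    Sop (v n) (cl t)) @ U) by rewrite (cvg_lim (@Rhausdorff R) (zP t)).
  have -> : (fun n => Sop (v n) (cl t)) = cst 0.
    by apply/funext => n; rewrite /cl clip_lo// Sop0.
  exact: (cvg_lim (@Rhausdorff R) (cvg_cst _)).
(* Near each [t], averaging bounds [v n - z] by values of [Sop (v n) - z] at nearby times;
   equicontinuity and the limit at [t] make these small, and compactness of [[0, 1]] makes the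
   estimate uniform. *)
have unif e : 0 < e -> U [set n | forall t, t \in `[0, 1] -> `|v n t - z t| <= e].
  move=> e0.
  have /compact_near_coveringP/near_covering_withinP := @segment_compact R 0 1.
  move=> /(_ nat U (fun n t => `|v n t - z t| <= e)) H.
  apply: filterS (H _ _) => [n Hn t t01|]; first exact: Hn.
  move=> t; rewrite /= in_itv/= => t01.
  have e30 : 0 < e / 3 by rewrite divr_gt0.
  have [d d0 dP] := equi t (e / 3) e30.
  have d20 : 0 < d / 2 by rewrite divr_gt0.
  have d40 : 0 < d / 4 by rewrite divr_gt0.
  (* A time [s] seen from [t'] is at distance at most [2 / (n + n0).+1], less than [2 * (d / 4)];
     hence it stays within [d] of [t]. *)
  exists ([set t' | `|t - t'| < d / 2],
          [set n | n.+1%:R^-1 < d / 4 /\ `|Sop (v n) (cl t) - z t| < e / 3]).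
    split.
      by apply/nbhs_ballP; exists (d / 2).
    apply: filterI; first by apply: sU; exact: (near_infty_natSinv_lt (PosNum d40)).
    by have /cvgrPdistC_lt := zP t; exact.
  move=> [t' n] /= [tt' [nd Sz]]; rewrite in_itv/= => t'01.
  have [_ _ _ +] := vP n; apply => // s s01 t's.
  have ts : `|t - s| < d.
    apply: (le_lt_trans (ler_distD t' _ _)).
    rewrite [ltRHS]splitr; apply: ltr_leD => //; apply: (le_trans t's).
    have nn : (n + n0).+1%:R^-1 <= n.+1%:R^-1 :> R.
      by rewrite lef_pV2 ?posrE// ler_nat ltnS leq_addr.
    apply: (@le_trans _ _ (2 * (d / 4))); last by lra.
    by rewrite ler_pM2l// (le_trans nn)// ltW.
  have [/(_ n) h1 _] := dP s ts.
  have h2 : `|z t - z t'| <= e / 3.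
    by apply: (dP t' _).2; apply: (lt_trans tt'); rewrite gtr_pMr// invf_lt1// ltr1n.
  rewrite (clE s s01) in h1.
  have -> : Sop (v n) s - z t' = (Sop (v n) s - Sop (v n) (cl t)) + (Sop (v n) (cl t) - z t) + (z t - z t') by ring.
  apply: (le_trans (ler_normD _ _)); apply: (le_trans (lerD (ler_normD _ _) h2)).
  rewrite (distrC (Sop (v n) s)); have := ltW Sz; lra.
exists z; split => //.
- move=> t t01.
  have /choice[s sP] : forall k : nat, exists n, (forall t, t \in `[0, 1] ->
    `|v n t - z t| <= k.+1%:R^-1) /\
      `|Sop (v n) t - z t| <= k.+1%:R^-1.
    move=> k; apply: (@filter_ex _ U); apply: filterI; first by apply: unif;
      rewrite invr_gt0.
    by have /cvgrPdistC_le := zP t; rewrite (clE t t01); apply; rewrite invr_gt0.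
  have c1 : (fun k => Sop (v (s k)) t) @ \oo --> Sop z t.
    apply: (Sop_cvg (M := M)) => //; first by move=> k t'; exact: vM.
    move=> e e0; have := near_infty_natSinv_lt (PosNum e0).
    by apply: filterS => k /= ke t' t'01; rewrite (le_trans ((sP k).1 t' t'01))// ltW.
  have c2 : (fun k => Sop (v (s k)) t) @ \oo --> z t.
    by apply: (@cvg_dist_natSinv _ _ _ 1) => k; rewrite mul1r; exact: (sP k).2.
  by rewrite -(cvg_lim (@Rhausdorff R) c1) (cvg_lim (@Rhausdorff R) c2).
- move=> t tab; apply/ler_addgt0Pr => e e0.
  have [n Hn] := @filter_ex _ U _ _ (unif e e0).
  have := Hn t; rewrite in_itv/= => /(_ (ab01 tab)); rewrite ler_norml => /andP[_ h].
  have [_ _ vdl _] := vP n.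
  by apply: (le_trans (vdl t tab)); rewrite addrC -lerBlDr.
Qed.

(** * The discretized operator and its fixed points *)

Hypothesis rab : r < b - a.
Hypothesis Phig : (0 < \int[leb]_(s in `[a, b]) (Ph s * g s)%:E)%E.

Let c_gt0 := cconst_gt0 beta_gt0 eta_gt0 be_le1 a_gt0 a_lt_b b_lt_be.
Let c_le1 := cconst_le1 beta_gt0 eta_gt0 be_le1 a_gt0 a_lt_b b_lt_be.

(** Collocation: interpolate, apply the operator, sample at the nodes. *)
Let nodal n (x : 'I_n.+1 -> R) : 'I_n.+1 -> R := fun j => Sop (pl x) (node a b j).

Let nodal_cone n (x : 'I_n.+1 -> R) : in_cone (@near_ab R a b n) c (nodal x).
Proof.
move=> i j Ii; apply: Sop_cone; [exact: pl_admissible|exact: node_ab|exact: node01].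
Qed.

Let nodal_cvg n (M : R) (x_ : nat -> 'I_n.+1 -> R) x : (forall k j, `|x_ k j| <= M) ->
  (forall i, x_ ^~ i @ \oo --> x i) ->
    forall i, (fun k => nodal (x_ k) i) @ \oo --> nodal x i.
Proof.
move=> xM xx i; apply: (Sop_cvg (M := M)).
- by move=> k; exact: pl_admissible.
- exact: pl_admissible.
- move=> k s; rewrite in_itv/= => /andP[_ s1]; apply: pl_le => //.
  exact: le_trans (xM 0%N ord0).
- exact: pl_unif_cvg.
- exact: node01.
Qed.

Let nodal_hi rho n (x : 'I_n.+1 -> R) : 0 < rho -> I1 r beta eta psi g A F rho ->
  (forall j, `|x j| <= rho) -> forall j, `|nodal x j| < rho.
Proof.
move=> rho0 HI1 xr j; apply: Sop_I1 => //; first exact: pl_admissible.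
by move=> t; rewrite in_itv/= => /andP[_ t1]; apply: pl_le => //; exact: ltW.
Qed.

(** A coordinate equal to [rho] in [near_ab] bounds all others by [rho / c] through the cone; the
    interpolant therefore has on [[a, b]] exactly the range required by [I0]. *)
Let nodal_lo rho n (x : 'I_n.+1 -> R) : n.+1%:R^-1 <= a -> 0 < rho ->
  I0 r beta eta a b g A F rho -> in_cone (@near_ab R a b n) c x ->
  (forall i, near_ab a b i -> rho <= x i) -> (exists2 i, near_ab a b i & x i = rho) ->
  forall i, near_ab a b i -> rho < nodal x i.
Proof.
move=> na rho0 HI0 Kx xr [i0 Ii0 xi0] i Ii; apply: Sop_I0 => //.
- exact: pl_admissible.
- move=> t; rewrite in_itv/= => tab; apply: (pl_itv b_le1 na tab) => j Ij; rewrite xr//=.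
  rewrite ler_pdivlMr// mulrC -xi0; apply: le_trans (Kx i0 j Ii0).
  by rewrite ler_wpM2l ?ler_norm// ltW.
- exact: node_ab.
Qed.

(** The condition [rho1 / c < rho2] is nondegeneracy of the annulus with inner bound [rho1] and
    outer radius [rho2]. *)
Lemma fixpoint_S1 : S1 r beta eta a b psi g A F ->
  exists z, [/\ adm z, forall t, 0 <= t <= 1 -> z t = Sop z t &
                forall t, a <= t <= b -> 0 < z t].
Proof.
move=> [rho1 [rho2 [[r1 r2] _ r12 HI0 HI1]]].
have [|z [az zS zd]] := @Sop_fixpoint_of_approx rho1 rho2 r1; last first.
  by exists z; split => // t /zd; exact: lt_le_trans.
move=> n na.
have r12' : rho1 < c * rho2 by rewrite -ltr_pdivrMl// mulrC.
have [||||x [Kx xd xr] xfix] := @cone_compression R n.+1 (@near_ab R a b n) c c_gt0 c_le1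
    rho1 rho2 r1 r12' (@nodal n).
- by move=> x _; exact: nodal_cone.
- by move=> x_ x Dx_ _ xx; apply: (nodal_cvg (M := rho2)) => // k;
    case: (Dx_ k) => _ _; exact.
- by move=> x [Kx xd xr] ex; exact: nodal_lo.
- by move=> x [Kx xd xr] _; exact: nodal_hi.
by exists x; split => // j; rewrite -[in RHS]xfix.
Qed.

(** The lower bound that passes to the limit is [c * rho1 / 2], whatever the mesh. *)
Lemma fixpoint_S2 : S2 r beta eta a b psi g A F ->
  exists z, [/\ adm z, forall t, 0 <= t <= 1 -> z t = Sop z t &
                forall t, a <= t <= b -> 0 < z t].
Proof.
move=> [rho1 [rho2 [[r1 r2] _ r12 HI1 HI0]]].
have dl0 : 0 < rho1 / (2 * rho2 / c) * rho2 by rewrite mulr_gt0// divr_gt0// divr_gt0//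
  mulr_gt0.
have [|z [az zS zd]] := @Sop_fixpoint_of_approx _ (2 * rho2 / c) dl0; last first.
  by exists z; split => // t /zd; exact: lt_le_trans.
move=> n na.
have [||||x [Kx xd xr xfix]] := @cone_expansion R n.+1 (@near_ab R a b n) c c_gt0 c_le1
    rho1 rho2 r1 r12 (@nodal n).
- by move=> x _; exact: nodal_cone.
- by move=> x_ x _ xb _ xx; exact: (nodal_cvg (M := 2 * rho2 / c)).
- by move=> x Kx xr; exact: nodal_hi.
- by move=> x Kx xd ex; exact: nodal_lo.
by exists x; split => // j; rewrite -[in RHS]xfix.
Qed.

End operator.

Theorem theorem5p1 (R : realType) (r beta eta a b : R)
    (psi g A : R -> R) (F : R -> (R -> R) -> R)
    (r_gt0 : 0 < r) (beta_gt0 : 0 < beta) (eta01 : 0 < eta < 1)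
    (sub_ab : `[a, b] `<=` `]0, beta + eta[)
    (sub_01 : `]0, beta + eta[ `<=` `]0, (1 : R)[)
    (ab_r : r < b - a)
    (Hpsi : psi_hyp r psi) (Hg : g_hyp beta eta g) (HF : F_hyp r F)
    (HA : A_hyp beta eta A)
    (Phig_gt0 :
       (0 < \int[leb]_(s in `[a, b]) (Phi beta eta s * g s)%:E)%E)
    (HS : S1 r beta eta a b psi g A F \/ S2 r beta eta a b psi g A F) :
  exists u : R -> R,
    [/\ is_solution r beta eta psi g A F u,
        nontrivial r psi u &
        forall t, t \in `[a, b] -> 0 < u t].
Proof.
have /andP[eta_gt0 _] := eta01.
have ab : a < b by rewrite -subr_gt0 (lt_trans r_gt0).
have a_gt0 : 0 < a.
  have := sub_ab a; rewrite /= !in_itv/= lexx (ltW ab) => /(_ isT).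
  by case/andP.
have b_lt_be : b < beta + eta.
  have := sub_ab b; rewrite /= !in_itv/= lexx (ltW ab) => /(_ isT).
  by case/andP.
(* Inclusion of the open intervals: otherwise the point 1 would belong to the smaller one. *)
have be_le1 : beta + eta <= 1.
  rewrite leNgt; apply/negP => be_gt1.
  have := sub_01 1; rewrite /= !in_itv/= ltr01 be_gt1 ltxx => /(_ isT).
  by case/andP.
have [z [az zS z_gt0]] : exists z, [/\ admissible z,
    forall t, 0 <= t <= 1 -> z t = Sop r beta eta psi g A F z t &
    forall t, a <= t <= b -> 0 < z t].
  by case: HS => h; [apply: fixpoint_S1 h|apply: fixpoint_S2 h].
have psi0 t : a <= t <= b -> psi t = 0.
  move=> /andP[ta tb]; apply: Hpsi.2.
  by rewrite in_itv/= (le_trans (ltW a_gt0) ta)/= (le_trans tb)// (le_trans (ltW b_lt_be)).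
exists (fun t => psi t + z t); split.
- exact: Sop_solution.
- have aab : a <= a <= b by rewrite lexx ltW.
  exists a; last by rewrite psi0// add0r gt_eqF ?z_gt0.
  rewrite in_itv/= (le_trans _ (ltW a_gt0)) ?oppr_le0 ?(ltW r_gt0)//=.
  by rewrite (le_trans (ltW ab))// (le_trans (ltW b_lt_be)).
- by move=> t; rewrite in_itv/= => tab; rewrite psi0// add0r z_gt0.
Qed.
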